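(* Let $R>1$ and let $\phi(t)$ be analytic in the disc $|t-1|<R$. Let $a,d$ be complex numbers such that $2a+1$ and $d$ are not in $\{0,-1,-2,\ldots\}$. Suppose that $a$, $d$ and $\phi$ are such that the order of summation in $$\sum_{k=0}^\infty \frac{2^k (a)_k (d+1)_k}{(2a+1)_k (d)_k\,k!}\,\sum_{n=k}^\infty \frac{(-1)^n}{n!}\,(-n)_k\, \phi^{(n)}(1)$$ may be inverted, i.e. this iterated series converges, the iterated series $$\sum_{n=0}^\infty \frac{(-1)^n\phi^{(n)}(1)}{n!}\sum_{k=0}^n \frac{2^k (a)_k (d+1)_k(-n)_k}{(2a+1)_k (d)_k\,k!}$$ converges, and the two have the same value. Then $$\sum_{k=0}^\infty \frac{2^k(a)_k (d+1)_k\,\phi^{(k)}(0)}{(2a+1)_k (d)_k\,k!}=\sum_{k=0}^\infty\frac{ \phi^{(2k)}(1)}{2^{2k}\left(a+\frac12\right)_k\,k!}-\frac{1-2a/d}{2a+1} \sum_{k=0}^\infty \frac{ \phi^{(2k+1)}(1)}{2^{2k}\left(a+\frac32\right)_k\,k!}.$$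
   Context: $(x)_k$ denotes the Pochhammer symbol $(x)_k=x(x+1)\cdots(x+k-1)$ for $k\ge 1$, with $(x)_0=1$ (equal to $\Gamma(x+k)/\Gamma(x)$ when the latter is defined). $\phi^{(k)}$ denotes the $k$-th derivative of $\phi$. *)

(* Defs.v *)
From Stdlib Require Import Reals Factorial.
From Coquelicot Require Import Coquelicot.

Open Scope C_scope.

Fixpoint Cpoch (x : C) (k : nat) : C :=
  match k with
  | O => 1
  | S k' => Cpoch x k' * (x + INR k')
  end.

(* [C_derive] is a total operator, computed along the real direction; by
   [C_derive_correct] it is the complex derivative wherever that exists. *)
Definition Cderive_n (f : C -> C) (k : nat) : C -> C := Nat.iter k C_derive f.

(* Convergence of the ordinary partial sums.  [C] is also a normed module over
   [R], so the module structure is fixed here. *)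
Definition Cis_series (u : nat -> C) (l : C) : Prop :=
  @is_series C_AbsRing C_NormedModule u l.

Definition Csum_n (u : nat -> C) (n : nat) : C := @sum_n C_AbelianMonoid u n.

Definition analytic_at (f : C -> C) (z0 : C) : Prop :=
  exists (c : nat -> C) (r : R), (0 < r)%R /\
    forall z : C, (Cmod (z - z0) < r)%R ->
      @is_pseries C_AbsRing C_NormedModule c (z - z0) (f z).

Definition analytic_in_disc (f : C -> C) (z0 : C) (R0 : R) : Prop :=
  forall z : C, (Cmod (z - z0) < R0)%R -> analytic_at f z.

Definition nonpos_integer (z : C) : Prop := exists m : nat, z = - RtoC (INR m).

Definition hyp_coef (a d : C) (k : nat) : C :=
  2 ^ k * Cpoch a k * Cpoch (d + 1) k
  / (Cpoch (2 * a + 1) k * Cpoch d k * INR (fact k)).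

(* The term of index [n = k + m] of the inner series over [n >= k]. *)
Definition inner_term (phi : C -> C) (k m : nat) : C :=
  let n := (k + m)%nat in
  (- (1)) ^ n / INR (fact n) * Cpoch (- INR n) k * Cderive_n phi n 1.

(* Both iterated series converge, with the same value.  [T k] is the value of
   the inner series over [n >= k]; the other inner sum is finite. *)
Definition summation_invertible (a d : C) (phi : C -> C) : Prop :=
  exists (T : nat -> C) (S : C),
    (forall k : nat, Cis_series (inner_term phi k) (T k)) /\
    Cis_series (fun k => hyp_coef a d k * T k) S /\
    Cis_series
      (fun n => (- (1)) ^ n * Cderive_n phi n 1 / INR (fact n)
                * Csum_n (fun k => hyp_coef a d k * Cpoch (- INR n) k) n) S.

(* Main.v *)
Require Import Defs.
From Stdlib Require Import Reals Factorial Lra Lia.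
From Coquelicot Require Import Coquelicot.
Open Scope C_scope.

(** The inner series over [n >= k] is the Taylor series about 1 of the [k]-th
    derivative of [phi], evaluated at 0, so the first iterated series is the left
    side of the identity.  In the other order the inner sum is the terminating
    series [3F2(-n, a, d+1; 2a+1, d; 2)].  It has a closed form depending on the
    parity of [n], and its even and odd values produce the two series on the
    right.

    Evaluation of the finite sum.  With [G_n = 2F1(-n, a; 2a+1; 2)] the sum is
    [G_n + (n/d) (G_n - G_(n-1))], because [(d+1)_k / (d)_k = 1 + k/d]
    ([neg_sum_kummer]).  The sequence satisfies
    [(2a+2+n) G_(n+2) = G_(n+1) + (n+1) G_n] ([kummer_sum_rec]), which decouples
    into [G_(2j+2) = G_(2j+1)] and [(2a+1+2j) G_(2j+1) = (2j+1) G_(2j)]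
    ([kummer_sum_odd]).  Hence the finite sum is [G_n] for even [n] and
    [(1 - 2a/d) G_n] for odd [n].

    Global Taylor expansion.  Analyticity is given by local power series, whereas
    two global facts are needed: the Taylor series about 1 represents [phi] and its
    derivatives at 0, and its coefficients [c_n] decay geometrically, which is
    where [R0 > 1] enters.  Both follow from Cauchy's integral formula on a circle
    of radius between 1 and [R0].  The formula is obtained by contracting the
    circle to the evaluation point ([cauchy_homotopy]), for which a continuous
    complex derivative suffices; this comes from a quadratic Taylor estimate
    ([analytic_quad_taylor]).  Expanding the Cauchy kernel gives
    [analytic_disc_taylor].

    Conclusion.  The two series on the right have terms [c_(2j) G_(2j)] and
    [(2a+1) c_(2j+1) G_(2j+1)].  As [G] grows slower than every geometric sequence,
    both converge, and pairing consecutive terms of the second iterated series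
    expresses its value through their sums. *)

(** * Finite sums, Pochhammer symbols and binomial transforms *)

Lemma Csum_n_S (u : nat -> C) (n : nat) :
  Csum_n u (S n) = Csum_n u n + u (S n).
Proof. apply (@sum_Sn C_AbelianMonoid). Qed.

Lemma Csum_n_0 (u : nat -> C) : Csum_n u 0 = u O.
Proof. apply (@sum_O C_AbelianMonoid). Qed.

(** [altdiff v n] is the alternating binomial transform
    [sum_k (-1)^k binom(n,k) v_k]; defining it as the iterated difference
    [(1 - shift)^n v] at 0 makes Pascal's rule its recursive equation. *)
Fixpoint altdiff (v : nat -> C) (n : nat) : C :=
  match n with
  | O => v O
  | S m => altdiff v m - altdiff (fun k => v (S k)) m
  end.

Lemma altdiff_ext (v w : nat -> C) (n : nat) :
  (forall k, v k = w k) -> altdiff v n = altdiff w n.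
Proof.
revert v w; induction n as [|n IH]; intros v w H; simpl; [apply H|].
rewrite (IH v w H), (IH (fun k => v (S k)) (fun k => w (S k))); auto.
Qed.

Lemma altdiff_lin (x y : C) (v w : nat -> C) (n : nat) :
  altdiff (fun k => x * v k + y * w k) n = x * altdiff v n + y * altdiff w n.
Proof.
revert v w; induction n as [|n IH]; intros v w; simpl; [reflexivity|].
rewrite IH, (IH (fun k => v (S k)) (fun k => w (S k))); ring.
Qed.

Lemma INR_C_S (n : nat) : RtoC (INR (S n)) = INR n + 1.
Proof. rewrite S_INR; apply RtoC_plus. Qed.

(** Multiplying [v] by the index acts on the transform as the operator
    [n (1 - backward shift)].  Together with the recursive equation, which says
    what shifting [v] does, this turns a first-order recurrence of [v] into a
    recurrence of its transform. *)
Lemma altdiff_index (v : nat -> C) (n : nat) :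
  altdiff (fun k => INR k * v k) (S n)
  = INR (S n) * (altdiff v (S n) - altdiff v n).
Proof.
revert v; induction n as [|n IH]; intros v.
- simpl; ring.
- change (altdiff (fun k => INR k * v k) (S (S n)))
    with (altdiff (fun k => INR k * v k) (S n)
          - altdiff (fun k => INR (S k) * v (S k)) (S n)).
  assert (E : altdiff (fun k => INR (S k) * v (S k)) (S n)
    = altdiff (fun k => 1 * (INR k * v (S k)) + 1 * v (S k)) (S n)).
  { apply altdiff_ext; intros k; rewrite INR_C_S; ring. }
  rewrite E, altdiff_lin, IH, (IH (fun k => v (S k))).
  rewrite !INR_C_S.
  change (altdiff v (S (S n)))
    with (altdiff v (S n) - altdiff (fun k => v (S k)) (S n)).
  change (altdiff v (S n)) with (altdiff v n - altdiff (fun k => v (S k)) n).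
  ring.
Qed.

Lemma Cpoch_shift (x : C) (k : nat) : Cpoch x (S k) = x * Cpoch (x + 1) k.
Proof.
induction k as [|k IH]; [simpl; ring|].
change (Cpoch x (S (S k))) with (Cpoch x (S k) * (x + INR (S k))).
rewrite IH; cbn [Cpoch]; rewrite INR_C_S; ring.
Qed.

Lemma Cpoch_neq_0 (x : C) (k : nat) : ~ nonpos_integer x -> Cpoch x k <> 0.
Proof.
intros H; induction k as [|k IH]; simpl.
- intros E; apply RtoC_inj in E; lra.
- apply Cmult_neq_0; [exact IH|intros E; apply H; exists k].
  replace x with (x + INR k - INR k) by ring; rewrite E; ring.
Qed.

Lemma RtoC_neq_0 (r : R) : r <> 0%R -> RtoC r <> 0.
Proof. intros H E; apply H, RtoC_inj, E. Qed.

Lemma INR_C_S_neq_0 (k : nat) : RtoC (INR (S k)) <> 0.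
Proof. apply RtoC_neq_0, not_0_INR; lia. Qed.

Lemma fact_C_neq_0 (k : nat) : RtoC (INR (fact k)) <> 0.
Proof. apply RtoC_neq_0, INR_fact_neq_0. Qed.

Lemma fact_C_S (k : nat) :
  RtoC (INR (fact (S k))) = INR (S k) * INR (fact k).
Proof. rewrite fact_simpl, mult_INR; apply RtoC_mult. Qed.

(** [neg_binom n k] is [(-1)^k binom(n,k)], in the Pochhammer form of the series. *)
Definition neg_binom (n k : nat) : C := Cpoch (- INR n) k / INR (fact k).

Lemma neg_binom_pascal (n k : nat) :
  neg_binom (S n) (S k) = neg_binom n (S k) - neg_binom n k.
Proof.
unfold neg_binom; rewrite Cpoch_shift, fact_C_S.
replace (- INR (S n) + 1) with (- INR n) by (rewrite INR_C_S; ring).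
cbn [Cpoch]; rewrite !INR_C_S.
field; split; [apply fact_C_neq_0|].
rewrite <- INR_C_S; apply INR_C_S_neq_0.
Qed.

Lemma neg_binom_0 (n : nat) : neg_binom n 0 = 1.
Proof. unfold neg_binom; simpl; field; apply RtoC_neq_0; lra. Qed.

Lemma Cpoch_neg_over (n : nat) : Cpoch (- INR n) (S n) = 0.
Proof. simpl; ring. Qed.

Lemma Csum_n_shift (u : nat -> C) (n : nat) :
  Csum_n u (S n) = u O + Csum_n (fun k => u (S k)) n.
Proof.
induction n as [|n IH]; [now rewrite Csum_n_S, !Csum_n_0|].
rewrite Csum_n_S, IH, Csum_n_S; ring.
Qed.

Lemma Csum_n_minus (u v : nat -> C) (n : nat) :
  Csum_n (fun k => u k - v k) n = Csum_n u n - Csum_n v n.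
Proof.
induction n as [|n IH]; [now rewrite !Csum_n_0|].
rewrite !Csum_n_S, IH; ring.
Qed.

Lemma Csum_n_ext (u v : nat -> C) (n : nat) :
  (forall k, (k <= n)%nat -> u k = v k) -> Csum_n u n = Csum_n v n.
Proof. apply (@sum_n_ext_loc C_AbelianMonoid). Qed.

Lemma altdiff_sum (v : nat -> C) (n : nat) :
  Csum_n (fun k => neg_binom n k * v k) n = altdiff v n.
Proof.
revert v; induction n as [|n IH]; intros v.
- rewrite Csum_n_0, neg_binom_0; simpl; ring.
- rewrite Csum_n_shift, neg_binom_0.
  rewrite (Csum_n_ext _ (fun k => neg_binom n (S k) * v (S k)
                                  - neg_binom n k * v (S k)))
    by (intros; rewrite neg_binom_pascal; ring).
  rewrite Csum_n_minus, (IH (fun k => v (S k))).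
  simpl altdiff; rewrite <- (IH v).
  assert (E : Csum_n (fun k => neg_binom n k * v k) (S n)
              = Csum_n (fun k => neg_binom n k * v k) n).
  { rewrite Csum_n_S; unfold neg_binom at 2; rewrite Cpoch_neg_over.
    field; apply fact_C_neq_0. }
  rewrite <- E, (Csum_n_shift _ n), neg_binom_0; ring.
Qed.

(** For closing an equation that is a known one up to [ring] rearrangement. *)
Lemma C_eq_of_sub (x y l r : C) : l = r -> x - y = r - l -> x = y.
Proof.
intros H E; replace x with (x - y + y) by ring; rewrite E, H; ring.
Qed.

Definition kummer_coef (a : C) (k : nat) : C :=
  2 ^ k * Cpoch a k / Cpoch (2 * a + 1) k.

(** The terminating hypergeometric value [2F1(-n, a; 2a+1; 2)]. *)
Definition kummer_sum (a : C) (n : nat) : C := altdiff (kummer_coef a) n.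

Lemma kummer_coef_S (a : C) (k : nat) :
  ~ nonpos_integer (2 * a + 1) ->
  (2 * a + 1 + INR k) * kummer_coef a (S k) = 2 * (a + INR k) * kummer_coef a k.
Proof.
intros ha; unfold kummer_coef.
assert (H := Cpoch_neq_0 _ (S k) ha); cbn [Cpoch] in *; rewrite Cpow_S.
field; split; intros E; apply H; rewrite E; ring.
Qed.

(** The transform of [kummer_coef_S] under [altdiff].  At argument 2 with
    parameters [a] and [2a+1] the middle coefficient of the contiguous relation
    loses its dependence on [n] and [a]. *)
Lemma kummer_sum_rec (a : C) (n : nat) :
  ~ nonpos_integer (2 * a + 1) ->
  (2 * a + 1 + INR (S n)) * kummer_sum a (S (S n))
  = kummer_sum a (S n) + INR (S n) * kummer_sum a n.
Proof.
intros ha; set (v := kummer_coef a).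
assert (E : altdiff (fun k => 2 * a * v (S k) + 1 * (INR (S k) * v (S k))) (S n)
   = altdiff (fun k => 2 * a * v k + 2 * (INR k * v k)) (S n)).
{ apply altdiff_ext; intros k.
  transitivity ((2 * a + 1 + INR k) * v (S k)); [rewrite INR_C_S; ring|].
  unfold v; rewrite (kummer_coef_S a k ha); ring. }
rewrite !altdiff_lin, altdiff_index in E.
assert (E2 : altdiff (fun k => v (S k)) (S n)
             = altdiff v (S n) - altdiff v (S (S n))) by (simpl; ring).
assert (E3 : altdiff (fun k => INR (S k) * v (S k)) (S n)
  = altdiff (fun k => INR k * v k) (S n)
    - altdiff (fun k => INR k * v k) (S (S n))) by (simpl; ring).
rewrite E3, !altdiff_index, E2 in E.
unfold kummer_sum; fold v.
rewrite !INR_C_S in *.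
eapply C_eq_of_sub; [exact E|ring].
Qed.

Lemma INR_C_double (j : nat) : RtoC (INR (2 * j)) = 2 * INR j.
Proof. rewrite mult_INR, RtoC_mult; simpl; f_equal. Qed.

Lemma add_INR_neq_0 (x : C) (k : nat) : ~ nonpos_integer x -> x + INR k <> 0.
Proof.
intros H E; apply H; exists k.
replace x with (x + INR k - INR k) by ring; rewrite E; ring.
Qed.

Lemma nonpos_free_neq_0 (x : C) : ~ nonpos_integer x -> x <> 0.
Proof.
intros H E; apply (add_INR_neq_0 x 0 H); rewrite E; simpl; ring.
Qed.

Lemma Cmult_cancel (c x y : C) : c <> 0 -> c * x = c * y -> x = y.
Proof.
intros Hc E; replace x with (/ c * (c * x)) by (field; exact Hc).
rewrite E; field; exact Hc.
Qed.

(** The three-term recurrence splits by parity: both two-term relations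
    follow from it by induction, each from the other. *)
Lemma kummer_sum_odd (a : C) (j : nat) :
  ~ nonpos_integer (2 * a + 1) ->
  (2 * a + 1 + 2 * INR j) * kummer_sum a (S (2 * j))
  = (2 * INR j + 1) * kummer_sum a (2 * j)
  /\ kummer_sum a (S (S (2 * j))) = kummer_sum a (S (2 * j)).
Proof.
intros ha.
assert (step : forall j,
  (2 * a + 1 + 2 * INR j) * kummer_sum a (S (2 * j))
    = (2 * INR j + 1) * kummer_sum a (2 * j) ->
  kummer_sum a (S (S (2 * j))) = kummer_sum a (S (2 * j))).
{ intros i Hi; assert (R := kummer_sum_rec a (2 * i) ha).
  apply (Cmult_cancel (2 * a + 1 + INR (S (2 * i)))).
  - apply add_INR_neq_0, ha.
  - rewrite R; rewrite INR_C_S, INR_C_double in *.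
    eapply C_eq_of_sub; [exact Hi|ring]. }
induction j as [|j [IH1 IH2]].
- assert (H : (2 * a + 1 + 2 * INR 0) * kummer_sum a (S (2 * 0))
    = (2 * INR 0 + 1) * kummer_sum a (2 * 0)).
  { unfold kummer_sum, kummer_coef; simpl.
    assert (H := add_INR_neq_0 _ 0 ha); simpl in H.
    field; intros E; apply H; rewrite E; ring. }
  split; [exact H|apply step, H].
- assert (H : (2 * a + 1 + 2 * INR (S j)) * kummer_sum a (S (2 * S j))
    = (2 * INR (S j) + 1) * kummer_sum a (2 * S j)).
  { replace (2 * S j)%nat with (S (S (2 * j))) by lia.
    assert (R := kummer_sum_rec a (S (2 * j)) ha).
    rewrite !INR_C_S, INR_C_double in *.
    rewrite IH2 in R |- *.
    eapply C_eq_of_sub; [symmetry; exact R|ring]. }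
  split; [exact H|apply step, H].
Qed.

Lemma half_poch_neq_0 (a x : C) (m j : nat) :
  ~ nonpos_integer (2 * a + 1) -> x = a + 1 / 2 + INR m -> Cpoch x j <> 0.
Proof.
intros ha ->; apply Cpoch_neq_0; intros [p Hp].
apply (add_INR_neq_0 _ (2 * m + 2 * p) ha).
rewrite plus_INR, RtoC_plus, !INR_C_double.
eapply C_eq_of_sub; [exact (f_equal (fun z => 2 * z) (eq_sym Hp))|].
field. all: apply RtoC_neq_0; lra.
Qed.

(** Since [(d+1)_k / (d)_k = 1 + k/d], the parameter pair [d+1, d] only adds
    [1/d] times the transform of [k v_k], known from [altdiff_index]. *)
Lemma neg_sum_kummer (a d : C) (n : nat) :
  ~ nonpos_integer (2 * a + 1) -> ~ nonpos_integer d ->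
  Csum_n (fun k => hyp_coef a d k * Cpoch (- INR n) k) n
  = kummer_sum a n
    + / d * altdiff (fun k => INR k * kummer_coef a k) n.
Proof.
intros ha hd.
assert (d0 := nonpos_free_neq_0 d hd).
assert (H : forall k, hyp_coef a d k * Cpoch (- INR n) k
  = neg_binom n k * (1 * kummer_coef a k + / d * (INR k * kummer_coef a k))).
{ intros k; unfold hyp_coef, neg_binom, kummer_coef.
  assert (S : d * Cpoch (d + 1) k = Cpoch d k * (d + INR k))
    by (rewrite <- Cpoch_shift; reflexivity).
  assert (dk := Cpoch_neq_0 d k hd).
  assert (E : Cpoch (d + 1) k = Cpoch d k * (1 + / d * INR k)).
  { apply (Cmult_cancel d _ _ d0); rewrite S; field; exact d0. }
  rewrite E; field.
  repeat split; auto using fact_C_neq_0, Cpoch_neq_0. }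
rewrite (Csum_n_ext _ _ n (fun k _ => H k)), altdiff_sum, altdiff_lin.
unfold kummer_sum; ring.
Qed.

Lemma hyp_sum_even (a d : C) (j : nat) :
  ~ nonpos_integer (2 * a + 1) -> ~ nonpos_integer d ->
  Csum_n (fun k => hyp_coef a d k * Cpoch (- INR (2 * j)) k) (2 * j)
  = kummer_sum a (2 * j).
Proof.
intros ha hd; rewrite (neg_sum_kummer a d _ ha hd).
assert (E : altdiff (fun k => INR k * kummer_coef a k) (2 * j) = 0).
{ destruct j as [|j]; [simpl; ring|].
  replace (2 * S j)%nat with (S (S (2 * j))) by lia.
  rewrite altdiff_index; fold (kummer_sum a (S (S (2 * j)))).
  fold (kummer_sum a (S (2 * j))).
  rewrite (proj2 (kummer_sum_odd a j ha)); ring. }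
rewrite E; ring.
Qed.

Lemma hyp_sum_odd (a d : C) (j : nat) :
  ~ nonpos_integer (2 * a + 1) -> ~ nonpos_integer d ->
  Csum_n (fun k => hyp_coef a d k * Cpoch (- INR (S (2 * j))) k) (S (2 * j))
  = (1 - 2 * a / d) * kummer_sum a (S (2 * j)).
Proof.
intros ha hd; rewrite (neg_sum_kummer a d _ ha hd), altdiff_index.
fold (kummer_sum a (2 * j)); fold (kummer_sum a (S (2 * j))).
assert (E := proj1 (kummer_sum_odd a j ha)).
rewrite INR_C_S, INR_C_double.
eapply C_eq_of_sub; [exact (f_equal (fun z => / d * z) (eq_sym E))|].
field; apply nonpos_free_neq_0, hd.
Qed.

Lemma kummer_sum_even_closed (a : C) (j : nat) :
  ~ nonpos_integer (2 * a + 1) ->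
  kummer_sum a (2 * j) * (2 ^ (2 * j) * Cpoch (a + 1 / 2) j * INR (fact j))
  = INR (fact (2 * j)).
Proof.
intros ha; induction j as [|j IH].
- unfold kummer_sum, kummer_coef; simpl; field; apply RtoC_neq_0; lra.
- destruct (kummer_sum_odd a j ha) as [E1 E2].
  replace (2 * S j)%nat with (S (S (2 * j))) by lia.
  rewrite E2, !fact_C_S, <- IH, !Cpow_S, !INR_C_S, !INR_C_double.
  cbn [Cpoch].
  eapply C_eq_of_sub;
    [exact (f_equal (fun z => 2 * (INR j + 1) * 2 ^ (2 * j)
        * Cpoch (a + 1 / 2) j * INR (fact j) * z) (eq_sym E1))|].
  field. all: try (apply RtoC_neq_0; lra).
Qed.

Lemma kummer_sum_odd_closed (a : C) (j : nat) :
  ~ nonpos_integer (2 * a + 1) ->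
  kummer_sum a (S (2 * j)) * ((2 * a + 1)
    * (2 ^ (2 * j) * Cpoch (a + 3 / 2) j * INR (fact j)))
  = INR (fact (S (2 * j))).
Proof.
intros ha.
assert (E := proj1 (kummer_sum_odd a j ha)).
rewrite fact_C_S, INR_C_S, INR_C_double, <- (kummer_sum_even_closed a j ha).
assert (P : (a + 1 / 2) * Cpoch (a + 3 / 2) j
            = Cpoch (a + 1 / 2) j * (a + 1 / 2 + INR j)).
{ replace (a + 3 / 2) with (a + 1 / 2 + 1)
    by (field; apply RtoC_neq_0; lra).
  rewrite <- Cpoch_shift; reflexivity. }
transitivity (kummer_sum a (S (2 * j)) * 2 ^ (2 * j) * INR (fact j)
  * (2 * ((a + 1 / 2) * Cpoch (a + 3 / 2) j))).
{ field; apply RtoC_neq_0; lra. }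
rewrite P.
eapply C_eq_of_sub;
    [exact (f_equal (fun z => 2 ^ (2 * j)
        * Cpoch (a + 1 / 2) j * INR (fact j) * z) (eq_sym E))|].
field. all: try (apply RtoC_neq_0; lra).
Qed.

(** * Series of complex numbers *)

Lemma Csum_n_pair (u : nat -> C) (n : nat) :
  Csum_n u n = (sum_n (fun k => Re (u k)) n, sum_n (fun k => Im (u k)) n).
Proof.
induction n as [|n IH].
- rewrite Csum_n_0, !sum_O; destruct (u O); reflexivity.
- rewrite Csum_n_S, IH, !sum_Sn; reflexivity.
Qed.

Lemma Cis_series_lim (u : nat -> C) (l : C) :
  Cis_series u l <-> is_lim_seq (fun n => Cmod (Csum_n u n - l)) 0.
Proof.
split.
- intros H; apply is_lim_seq_spec; intros eps.
  assert (He : (0 < eps / 2)%R) by (destruct eps; simpl; lra).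
  assert (H' := proj1 (filterlim_locally (U := C_UniformSpace) (Csum_n u) l) H
                 (mkposreal _ He)).
  revert H'; apply filter_imp; intros n Hn.
  apply C_NormedModule_mixin_compat2 in Hn; simpl in Hn.
  rewrite Rminus_0_r, Rabs_pos_eq by apply Cmod_ge_0.
  assert (S2 : (sqrt 2 < 2)%R).
  { rewrite <- (sqrt_square 2) at 2 by lra; apply sqrt_lt_1; lra. }
  eapply Rlt_le_trans; [exact Hn|].
  replace (pos eps) with (2 * (eps / 2))%R at 2 by field.
  apply Rmult_le_compat_r; lra.
- intros H; apply (proj2 (filterlim_locally _ _)); intros eps.
  apply is_lim_seq_spec in H; specialize (H eps); revert H.
  apply filter_imp; intros n Hn.
  rewrite Rminus_0_r, Rabs_pos_eq in Hn by apply Cmod_ge_0.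
  apply C_NormedModule_mixin_compat1; exact Hn.
Qed.

Lemma im_le_Cmod (z : C) : (Rabs (Im z) <= Cmod z)%R.
Proof. eapply Rle_trans; [apply Rmax_r|apply Rmax_Cmod]. Qed.

Lemma Cmod_le_re_im (z : C) : (Cmod z <= Rabs (Re z) + Rabs (Im z))%R.
Proof.
replace z with (RtoC (Re z) + Ci * RtoC (Im z)) at 1.
- eapply Rle_trans; [apply Cmod_triangle|].
  rewrite Cmod_mult, Cmod_Ci, !Cmod_R; lra.
- destruct z; apply injective_projections; simpl; ring.
Qed.

Lemma Cis_series_Re_Im (u : nat -> C) (l : C) :
  Cis_series u l <->
  is_series (fun n => Re (u n)) (Re l) /\ is_series (fun n => Im (u n)) (Im l).
Proof.
assert (T : forall (a : nat -> R) (x : R),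
  is_series a x <-> is_lim_seq (fun n => Rabs (sum_n a n - x)) 0).
{ intros a x; split; intros H.
  - apply (proj1 (is_lim_seq_abs_0 _)).
    apply is_lim_seq_ext with (fun n => sum_n a n - x)%R; [reflexivity|].
    replace 0%R with (x - x)%R by ring.
    apply is_lim_seq_minus'; [exact H|apply is_lim_seq_const].
  - apply (proj2 (is_lim_seq_abs_0 _)) in H.
    change (is_lim_seq (sum_n a) x).
    apply (is_lim_seq_ext (fun n => (sum_n a n - x) + x)%R);
      [intros; simpl; ring|].
    replace (Finite x) with (Finite (0 + x)) by (f_equal; ring).
    apply is_lim_seq_plus'; [exact H|apply is_lim_seq_const]. }
rewrite Cis_series_lim, !T; split.
- intros H; split; refine (is_lim_seq_le_le _ _ _ _ _ (is_lim_seq_const 0) H);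
    intros n; rewrite Csum_n_pair; (split; [apply Rabs_pos|]).
  + refine (Rle_trans _ _ _ _ (re_le_Cmod _)); apply Req_le; reflexivity.
  + refine (Rle_trans _ _ _ _ (im_le_Cmod _)); apply Req_le; reflexivity.
- intros [H1 H2].
  assert (H := is_lim_seq_plus' _ _ _ _ H1 H2); rewrite Rplus_0_r in H.
  refine (is_lim_seq_le_le _ _ _ _ _ (is_lim_seq_const 0) H).
  intros n; split; [apply Cmod_ge_0|].
  refine (Rle_trans _ _ _ (Cmod_le_re_im _) _).
  rewrite Csum_n_pair; apply Req_le; reflexivity.
Qed.

Lemma Cis_series_ext (u v : nat -> C) (l : C) :
  (forall n, u n = v n) -> Cis_series u l -> Cis_series v l.
Proof. apply is_series_ext. Qed.

Lemma Cis_series_scal (x : C) (u : nat -> C) (k : C) :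
  Cis_series u k -> Cis_series (fun n => x * u n) (x * k).
Proof. apply (is_series_scal (V := C_NormedModule) x u k). Qed.

Lemma Cis_series_lin (x y : C) (u v : nat -> C) (k l : C) :
  Cis_series u k -> Cis_series v l ->
  Cis_series (fun n => x * u n + y * v n) (x * k + y * l).
Proof.
intros Hu Hv; apply (is_series_plus (V := C_NormedModule)).
- apply (is_series_scal (V := C_NormedModule) x u k Hu).
- apply (is_series_scal (V := C_NormedModule) y v l Hv).
Qed.

Lemma Cis_series_unique (u : nat -> C) (k l : C) :
  Cis_series u k -> Cis_series u l -> k = l.
Proof.
intros Hk Hl.
apply (filterlim_locally_unique (K := C_AbsRing) (V := C_NormedModule) _ _ _ Hk Hl).
Qed.

(** The triangle inequality for series, in the form needed for majorants. *)
Lemma Cis_series_norm_le (u : nat -> C) (b : nat -> R) (l : C) (B : R) :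
  (forall n, (Cmod (u n) <= b n)%R) -> Cis_series u l -> is_series b B ->
  (Cmod l <= B)%R.
Proof.
intros H Hu Hb.
assert (P : forall n, (Cmod (Csum_n u n) <= sum_n b n)%R).
{ induction n as [|n IH]; [rewrite Csum_n_0, sum_O; apply H|].
  rewrite Csum_n_S, sum_Sn.
  refine (Rle_trans _ _ _ (Cmod_triangle _ _) _).
  apply Rplus_le_compat; [exact IH|apply H]. }
apply Cis_series_lim in Hu.
assert (L := is_lim_seq_plus' _ _ _ _ Hu Hb); rewrite Rplus_0_l in L.
refine (is_lim_seq_le _ _ (Cmod l) B _ (is_lim_seq_const _) L).
intros n; specialize (P n).
assert (T := Cmod_triangle (- (Csum_n u n - l)) (Csum_n u n)).
rewrite Cmod_opp in T.
replace (- (Csum_n u n - l) + Csum_n u n) with l in T by ring.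
exact (Rle_trans _ _ _ T (Rplus_le_compat_l _ _ _ P)).
Qed.

Lemma Cis_series_ex_le (u : nat -> C) (b : nat -> R) :
  (forall n, (Cmod (u n) <= b n)%R) -> ex_series b -> exists l, Cis_series u l.
Proof.
intros H [B Hb].
assert (Hr : ex_series (fun n => Re (u n))).
{ apply (ex_series_le (K := R_AbsRing) (V := R_CompleteNormedModule) _ b);
    [|exists B; exact Hb].
  intros n; exact (Rle_trans _ _ _ (re_le_Cmod _) (H n)). }
assert (Hi : ex_series (fun n => Im (u n))).
{ apply (ex_series_le (K := R_AbsRing) (V := R_CompleteNormedModule) _ b);
    [|exists B; exact Hb].
  intros n; exact (Rle_trans _ _ _ (im_le_Cmod _) (H n)). }
destruct Hr as [x Hx], Hi as [y Hy].
exists (x, y); apply Cis_series_Re_Im; split; assumption.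
Qed.

Lemma Cis_series_bounded (u : nat -> C) (l : C) :
  Cis_series u l -> exists M, forall n, (Cmod (u n) <= M)%R.
Proof.
assert (B : forall a : nat -> R, ex_series a ->
  exists M, forall n, (Rabs (a n) <= M)%R).
{ intros a Ha; apply ex_series_lim_0 in Ha.
  destruct (filterlim_bounded (K := R_AbsRing) (V := R_NormedModule) a)
    as [M HM]; [exists 0%R; exact Ha|exists M; exact HM]. }
intros H; apply Cis_series_Re_Im in H; destruct H as [H1 H2].
destruct (B _ (ex_intro _ _ H1)) as [M HM], (B _ (ex_intro _ _ H2)) as [N HN].
exists (M + N)%R; intros n.
refine (Rle_trans _ _ _ (Cmod_le_re_im _) _).
apply Rplus_le_compat; [apply HM|apply HN].
Qed.

Lemma Cis_pseries_pow (c : nat -> C) (z l : C) :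
  @is_pseries C_AbsRing C_NormedModule c z l ->
  Cis_series (fun n => c n * z ^ n) l.
Proof.
apply is_series_ext; intros n.
assert (E : pow_n (K := C_Ring) z n = z ^ n).
{ induction n as [|n IH]; [reflexivity|]; simpl; rewrite IH; reflexivity. }
change (pow_n (K := C_Ring) z n * c n = c n * z ^ n); rewrite E; ring.
Qed.

(** * Smoothness of analytic functions *)

(** The remainder [e_n] on the left satisfies
    [e_(n+1) = v e_n + n u^(n-1) (v - u)^2], so the bound follows by induction.
    The factor [r^2] avoids the exponent [n - 2]. *)
Lemma pow_taylor_quad (u v : C) (r : R) (n : nat) :
  (Cmod u <= r)%R -> (Cmod v <= r)%R ->
  (r ^ 2 * Cmod (v ^ n - u ^ n - INR n * u ^ pred n * (v - u))
   <= INR n ^ 2 * r ^ n * Cmod (v - u) ^ 2)%R.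
Proof.
intros Hu Hv.
assert (r0 : (0 <= r)%R) by (apply Rle_trans with (2 := Hu), Cmod_ge_0).
induction n as [|n IH].
- replace (v ^ 0 - u ^ 0 - INR 0 * u ^ pred 0 * (v - u)) with (RtoC 0)
    by (simpl; ring).
  rewrite Cmod_0; simpl; lra.
- set (e := v ^ n - u ^ n - INR n * u ^ pred n * (v - u)) in *.
  assert (E : v ^ S n - u ^ S n - INR (S n) * u ^ pred (S n) * (v - u)
     = v * e + INR n * u ^ pred n * (v - u) ^ 2).
  { unfold e; destruct n as [|n]; [simpl; ring|].
    rewrite (S_INR (S n)), RtoC_plus; simpl pred; rewrite !Cpow_S; simpl; ring. }
  rewrite E.
  assert (N := pos_INR n).
  assert (D := Cmod_ge_0 (v - u)).
  assert (P : (r * Cmod (INR n * u ^ pred n) <= INR n * r ^ n)%R).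
  { rewrite Cmod_mult, Cmod_pow, Cmod_R, (Rabs_pos_eq _ N).
    destruct n as [|n]; [simpl; lra|].
    simpl pred; rewrite <- tech_pow_Rmult.
    replace (r * (INR (S n) * Cmod u ^ n))%R
      with (INR (S n) * (r * Cmod u ^ n))%R by ring.
    apply Rmult_le_compat_l; [exact N|]; apply Rmult_le_compat_l; [exact r0|].
    apply pow_incr; split; [apply Cmod_ge_0|exact Hu]. }
  apply Rle_trans with (r * (r ^ 2 * Cmod e)
     + r * (r * Cmod (INR n * u ^ pred n)) * Cmod (v - u) ^ 2)%R.
  { apply Rle_trans with
      (r ^ 2 * (Cmod (v * e) + Cmod (INR n * u ^ pred n * (v - u) ^ 2)))%R.
    - apply Rmult_le_compat_l; [nra|apply Cmod_triangle].
    - rewrite (Cmod_mult v), (Cmod_mult (INR n * _)), (Cmod_pow (v - u)).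
      assert (C0 := Cmod_ge_0 e).
      assert (r ^ 2 * (Cmod v * Cmod e) <= r ^ 2 * (r * Cmod e))%R
        by (apply Rmult_le_compat_l; [nra|apply Rmult_le_compat_r; lra]).
      nra. }
  rewrite <- (tech_pow_Rmult r n), S_INR.
  assert (RN : (0 <= r ^ n)%R) by (apply pow_le, r0).
  apply Rle_trans with (r * (INR n ^ 2 * r ^ n * Cmod (v - u) ^ 2)
     + r * (INR n * r ^ n) * Cmod (v - u) ^ 2)%R.
  + apply Rplus_le_compat; [apply Rmult_le_compat_l; assumption|].
    apply Rmult_le_compat_r; [nra|apply Rmult_le_compat_l; assumption].
  + assert (X : (0 <= (r * r ^ n) * Cmod (v - u) ^ 2 * (INR n + 1))%R).
    { repeat apply Rmult_le_pos; try assumption; try lra; apply Rle_0_1. }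
    apply Rminus_le_0; refine (Rle_trans _ _ _ X _); apply Req_le; ring.
Qed.

Lemma sq_quarter_le (n : nat) : (INR n ^ 2 * (/ 4) ^ n <= 4 * (/ 2) ^ n)%R.
Proof.
assert (H : (INR n ^ 2 <= 4 * 2 ^ n)%R).
{ induction n as [|n IH]; [simpl; lra|].
  rewrite S_INR; simpl pow in *.
  destruct (Nat.le_gt_cases 3 n) as [L|L].
  - apply le_INR in L; simpl in L; nra.
  - destruct n as [|[|[|n]]]; simpl; try lra; lia. }
replace (/ 4)%R with (/ 2 * / 2)%R by field.
rewrite Rpow_mult_distr.
assert (P : (0 < (/ 2) ^ n)%R) by (apply pow_lt; lra).
assert (E : (2 ^ n * (/ 2) ^ n = 1)%R)
  by (rewrite <- Rpow_mult_distr; replace (2 * / 2)%R with 1%R by field; apply pow1).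
apply Rle_trans with (4 * 2 ^ n * (/ 2) ^ n * (/ 2) ^ n)%R.
- rewrite <- Rmult_assoc; apply Rmult_le_compat_r; [lra|].
  apply Rmult_le_compat_r; lra.
- apply Req_le; transitivity (4 * (2 ^ n * (/ 2) ^ n) * (/ 2) ^ n)%R;
    [ring|rewrite E; ring].
Qed.

(** A first-order Taylor expansion with quadratic remainder, uniform in the base
    point near [z0].  It packages complex differentiability near [z0] with local
    Lipschitz continuity of the derivative, which follows by exchanging the two
    points, and so gives all the smoothness that the integral formula needs. *)
Definition has_quad_taylor (f : C -> C) (z0 : C) : Prop :=
  exists (df : C -> C) (r M : R), (0 < r)%R /\
    forall w w', (Cmod (w - z0) < r)%R -> (Cmod (w' - z0) < r)%R ->
      (Cmod (f w' - f w - df w * (w' - w)) <= M * Cmod (w' - w) ^ 2)%R.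

(** The sums can be chosen without an axiom of choice because [Series] is total. *)
Lemma choose_sum (u : C -> nat -> C) (D : C -> Prop) :
  (forall w, D w -> exists l, Cis_series (u w) l) ->
  exists s : C -> C, forall w, D w -> Cis_series (u w) (s w).
Proof.
intros H.
exists (fun w => (Series (fun n => Re (u w n)), Series (fun n => Im (u w n)))).
intros w Hw; destruct (H w Hw) as [l Hl].
apply Cis_series_Re_Im in Hl; destruct Hl as [H1 H2].
apply Cis_series_Re_Im; simpl; split; apply Series_correct; eexists; eassumption.
Qed.

(** Sum [pow_taylor_quad] over the local power series.  On a disc of one
    quarter of a radius of convergence, the factor [n^2] is absorbed by a
    geometric series ([sq_quarter_le]). *)
Lemma analytic_quad_taylor (f : C -> C) (z0 : C) :
  analytic_at f z0 -> has_quad_taylor f z0.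
Proof.
intros (c & r0 & Hr0 & Hf).
set (r1 := (r0 / 2)%R); set (r := (r1 / 4)%R).
assert (Hr1 : (0 < r1 < r0)%R) by (unfold r1; lra).
assert (Hr : (0 < r < r0)%R) by (unfold r; lra).
assert (B : exists M, forall n, (Cmod (c n) * r1 ^ n <= M)%R).
{ assert (E : z0 + RtoC r1 - z0 = RtoC r1) by ring.
  assert (H : (Cmod (z0 + RtoC r1 - z0) < r0)%R)
    by (rewrite E, Cmod_R, Rabs_pos_eq; lra).
  specialize (Hf _ H); rewrite E in Hf; apply Cis_pseries_pow in Hf.
  destruct (Cis_series_bounded _ _ Hf) as [M HM]; exists M; intros n.
  specialize (HM n); rewrite Cmod_mult, Cmod_pow, Cmod_R, Rabs_pos_eq in HM; lra. }
destruct B as [M HM].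
(* [b] dominates both the derivative series and the remainder series. *)
set (b := fun n => (4 * M * (/ 2) ^ n)%R).
assert (Hb : forall n, (Cmod (c n) * (INR n ^ 2 * r ^ n) <= b n)%R).
{ intros n; unfold b, r, Rdiv; rewrite Rpow_mult_distr.
  specialize (HM n); assert (Q := sq_quarter_le n).
  assert (P : (0 <= Cmod (c n) * r1 ^ n)%R)
    by (apply Rmult_le_pos; [apply Cmod_ge_0|apply pow_le; lra]).
  replace (Cmod (c n) * (INR n ^ 2 * (r1 ^ n * (/ 4) ^ n)))%R
    with ((Cmod (c n) * r1 ^ n) * (INR n ^ 2 * (/ 4) ^ n))%R by ring.
  assert (P4 : (0 < (/ 2) ^ n)%R) by (apply pow_lt; lra).
  apply Rle_trans with ((Cmod (c n) * r1 ^ n) * (4 * (/ 2) ^ n))%R.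
  - apply Rmult_le_compat_l; assumption.
  - nra. }
assert (Sb : is_series b (8 * M)%R).
{ replace (8 * M)%R with (4 * M * / (1 - / 2))%R by field.
  apply (is_series_scal (4 * M)%R (fun n => (/ 2) ^ n)%R (/ (1 - / 2))%R).
  apply is_series_geom; rewrite Rabs_pos_eq; lra. }
destruct (choose_sum (fun w n => c n * (INR n * (w - z0) ^ pred n))
  (fun w => (Cmod (w - z0) < r)%R)) as [df Hdf].
{ intros w Hw.
  apply Cis_series_ex_le with (fun n => (/ r * b n)%R).
  - intros n; rewrite !Cmod_mult, Cmod_pow, Cmod_R, (Rabs_pos_eq _ (pos_INR n)).
    apply Rmult_le_reg_l with r; [lra|].
    replace (r * (/ r * b n))%R with (b n) by (field; lra).
    refine (Rle_trans _ _ _ _ (Hb n)).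
    rewrite <- Rmult_assoc, (Rmult_comm r), Rmult_assoc.
    apply Rmult_le_compat_l; [apply Cmod_ge_0|].
    destruct n as [|n]; [simpl; lra|].
    assert (N : (1 <= INR (S n))%R) by (rewrite S_INR; generalize (pos_INR n); lra).
    assert (P : (Cmod (w - z0) ^ n <= r ^ n)%R)
      by (apply pow_incr; split; [apply Cmod_ge_0|lra]).
    assert (P0 : (0 <= Cmod (w - z0) ^ n)%R) by apply pow_le, Cmod_ge_0.
    rewrite <- (tech_pow_Rmult r n); simpl (pred _).
    apply Rle_trans with (r * (INR (S n) ^ 2 * r ^ n))%R; [|apply Req_le; ring].
    apply Rmult_le_compat_l; [lra|].
    apply Rmult_le_compat; nra.
  - eexists; apply (is_series_scal (/ r)%R b _ Sb). }
exists df, r, (8 * M * / r ^ 2)%R; split; [lra|].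
intros w w' Hw Hw'.
set (u := w - z0) in *; set (v := w' - z0) in *.
assert (Evu : w' - w = v - u) by (unfold u, v; ring).
assert (Fw := Cis_pseries_pow _ _ _ (Hf w ltac:(fold u; lra))); fold u in Fw.
assert (Fw' := Cis_pseries_pow _ _ _ (Hf w' ltac:(fold v; lra))); fold v in Fw'.
assert (Dw := Hdf w Hw); cbv beta in Dw; fold u in Dw.
assert (L := Cis_series_lin 1 (- (v - u)) _ _ _ _
  (Cis_series_lin 1 (- (1)) _ _ _ _ Fw' Fw) Dw).
apply Rmult_le_reg_l with (r ^ 2)%R; [apply pow_lt; lra|].
replace (r ^ 2 * (8 * M * / r ^ 2 * Cmod (w' - w) ^ 2))%R
  with (Cmod (w' - w) ^ 2 * (8 * M))%R by (field; lra).
rewrite Evu.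
replace (f w' - f w - df w * (v - u))
  with (1 * (1 * f w' + - (1) * f w) + - (v - u) * df w) by ring.
rewrite <- (Rabs_pos_eq (r ^ 2)) at 1 by (apply pow_le; lra).
rewrite <- Cmod_R, <- Cmod_mult.
refine (Cis_series_norm_le _ (fun n => Cmod (v - u) ^ 2 * b n)%R _ _ _
   (Cis_series_scal (RtoC (r ^ 2)) _ _ L) _).
- intros n; cbv beta.
  replace (RtoC (r ^ 2) * (1 * (1 * (c n * v ^ n) + - (1) * (c n * u ^ n))
      + - (v - u) * (c n * (INR n * u ^ pred n))))
    with (c n * (RtoC (r ^ 2) * (v ^ n - u ^ n - INR n * u ^ pred n * (v - u))))
    by ring.
  rewrite Cmod_mult, Cmod_mult, Cmod_R, (Rabs_pos_eq (r ^ 2)) by (apply pow_le; lra).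
  assert (Q := pow_taylor_quad u v r n (Rlt_le _ _ Hw) (Rlt_le _ _ Hw')).
  apply Rle_trans with
    (Cmod (c n) * (INR n ^ 2 * r ^ n * Cmod (v - u) ^ 2))%R.
  + apply Rmult_le_compat_l; [apply Cmod_ge_0|exact Q].
  + rewrite <- Rmult_assoc, Rmult_comm.
    apply Rmult_le_compat_l; [apply pow_le, Cmod_ge_0|apply Hb].
- apply (is_series_scal (Cmod (v - u) ^ 2)%R b _ Sb).
Qed.

Lemma quad_taylor_C_derive (f : C -> C) (z0 : C) :
  has_quad_taylor f z0 ->
  exists r M : R, (0 < r)%R /\ (0 <= M)%R /\
    forall w w', (Cmod (w - z0) < r)%R -> (Cmod (w' - z0) < r)%R ->
      (Cmod (f w' - f w - C_derive f w * (w' - w)) <= M * Cmod (w' - w) ^ 2)%R.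
Proof.
intros (df & r & M0 & Hr & HM0).
set (M := Rabs M0).
assert (M0' : (0 <= M)%R) by apply Rabs_pos.
assert (HM : forall w w', (Cmod (w - z0) < r)%R -> (Cmod (w' - z0) < r)%R ->
      (Cmod (f w' - f w - df w * (w' - w)) <= M * Cmod (w' - w) ^ 2)%R).
{ intros w w' Hw Hw'; refine (Rle_trans _ _ _ (HM0 w w' Hw Hw') _).
  apply Rmult_le_compat_r; [apply pow_le, Cmod_ge_0|apply Rle_abs]. }
exists r, M; split; [exact Hr|split; [exact M0'|]].
intros w w' Hw Hw'.
replace (C_derive f w) with (df w); [apply HM; assumption|].
symmetry; apply is_C_derive_unique; split; [apply is_linear_scal_l|].
intros x Hx.
apply (is_filter_lim_locally_unique (K := C_AbsRing)
         (V := AbsRing_NormedModule C_AbsRing)) in Hx.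
subst x; intros eps.
assert (Hd : (0 < Rmin (r - Cmod (w - z0)) (eps / (M + 1)))%R).
{ apply Rmin_glb_lt; [lra|].
  apply Rdiv_lt_0_compat; [apply cond_pos|lra]. }
exists (mkposreal _ Hd); intros y Hy.
change (Cmod (y - w) < Rmin (r - Cmod (w - z0)) (eps / (M + 1)))%R in Hy.
change (Cmod (f y - f w - (y - w) * df w) <= eps * Cmod (y - w))%R.
assert (H1 := Rlt_le_trans _ _ _ Hy (Rmin_l _ _)).
assert (H2 := Rlt_le_trans _ _ _ Hy (Rmin_r _ _)).
assert (T := Cmod_triangle (y - w) (w - z0)).
replace (y - w + (w - z0)) with (y - z0) in T by ring.
rewrite (Cmult_comm (y - w)).
refine (Rle_trans _ _ _ (HM w y Hw ltac:(lra)) _).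
assert (P := Cmod_ge_0 (y - w)).
apply (Rmult_lt_compat_r (M + 1)) in H2; [|lra].
replace (eps / (M + 1) * (M + 1))%R with (pos eps) in H2 by (field; lra).
simpl pow; nra.
Qed.

Lemma quad_taylor_derive_continuous (f : C -> C) (z0 : C) :
  has_quad_taylor f z0 ->
  forall eps : R, (0 < eps)%R -> exists delta : R, (0 < delta)%R /\
    forall w, (Cmod (w - z0) < delta)%R ->
      (Cmod (C_derive f w - C_derive f z0) < eps)%R.
Proof.
intros H eps He; destruct (quad_taylor_C_derive f z0 H) as (r & M & Hr & M0 & HM).
exists (Rmin r (eps / (2 * M + 1))); split.
{ apply Rmin_glb_lt; [lra|apply Rdiv_lt_0_compat; lra]. }
intros w Hw.
assert (H1 := Rlt_le_trans _ _ _ Hw (Rmin_l _ _)).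
assert (H2 := Rlt_le_trans _ _ _ Hw (Rmin_r _ _)).
apply (Rmult_lt_compat_r (2 * M + 1)) in H2; [|lra].
replace (eps / (2 * M + 1) * (2 * M + 1))%R with eps in H2 by (field; lra).
assert (Hz : (Cmod (z0 - z0) < r)%R)
  by (replace (z0 - z0) with (RtoC 0) by ring; rewrite Cmod_0; exact Hr).
destruct (Req_dec (Cmod (w - z0)) 0) as [E|E].
{ apply Cmod_eq_0 in E.
  replace w with z0 by (rewrite <- (Cplus_0_r z0), <- E; ring).
  replace (C_derive f z0 - C_derive f z0) with (RtoC 0) by ring.
  rewrite Cmod_0; exact He. }
assert (P : (0 < Cmod (w - z0))%R) by (generalize (Cmod_ge_0 (w - z0)); lra).
(* Adding the expansions of [f] from [w] to [z0] and from [z0] to [w] leaves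
   only the difference of the derivatives. *)
assert (A := HM w z0 H1 Hz); assert (B := HM z0 w Hz H1).
assert (T := Cmod_triangle (f z0 - f w - C_derive f w * (z0 - w))
                           (f w - f z0 - C_derive f z0 * (w - z0))).
replace (f z0 - f w - C_derive f w * (z0 - w)
         + (f w - f z0 - C_derive f z0 * (w - z0)))
  with ((C_derive f w - C_derive f z0) * (w - z0)) in T by ring.
replace (Cmod (z0 - w)) with (Cmod (w - z0)) in A
  by (rewrite <- Cmod_opp; f_equal; ring).
rewrite Cmod_mult in T.
apply Rle_lt_trans with (2 * M * Cmod (w - z0))%R; [|nra].
apply Rmult_le_reg_r with (Cmod (w - z0)); [exact P|].
simpl pow in *; nra.
Qed.

Definition is_curve_derive (g : R -> C) (t : R) (l : C) : Prop :=
  is_derive (fun x => Re (g x)) t (Re l) /\ is_derive (fun x => Im (g x)) t (Im l).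

Definition curve_continuous (g : R -> C) (t : R) : Prop :=
  continuous (fun x => Re (g x)) t /\ continuous (fun x => Im (g x)) t.

(** The Cauchy-Riemann equations: the real linear map is multiplication by the
    complex derivative. *)
Lemma quad_taylor_differentiable (f : C -> C) (x y : R) :
  has_quad_taylor f (x, y) ->
  differentiable_pt_lim (fun u v => Re (f (u, v))) x y
    (Re (C_derive f (x, y))) (- Im (C_derive f (x, y))) /\
  differentiable_pt_lim (fun u v => Im (f (u, v))) x y
    (Im (C_derive f (x, y))) (Re (C_derive f (x, y))).
Proof.
intros H; destruct (quad_taylor_C_derive f _ H) as (r & M & Hr & M0 & HM).
set (l := C_derive f (x, y)) in *.
assert (K : forall eps : posreal,
  locally_2d (fun u v => Cmod (f (u, v) - f (x, y) - l * (u - x, v - y)%R)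
    <= eps * Rmax (Rabs (u - x)) (Rabs (v - y)))%R x y).
{ intros eps.
  assert (Hd : (0 < Rmin (r / 2) (eps / (4 * (M + 1))))%R).
  { apply Rmin_glb_lt; [lra|].
    apply Rdiv_lt_0_compat; [apply cond_pos|lra]. }
  exists (mkposreal _ Hd); intros u v Hu Hv; simpl pos in Hu, Hv.
  set (m := Rmax (Rabs (u - x)) (Rabs (v - y))).
  assert (Hm : (m < Rmin (r / 2) (eps / (4 * (M + 1))))%R)
    by (apply Rmax_lub_lt; assumption).
  assert (m0 : (0 <= m)%R) by (eapply Rle_trans; [apply Rabs_pos|apply Rmax_l]).
  assert (H1 := Rlt_le_trans _ _ _ Hm (Rmin_l _ _)).
  assert (H2 := Rlt_le_trans _ _ _ Hm (Rmin_r _ _)).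
  apply (Rmult_lt_compat_r (4 * (M + 1))) in H2; [|lra].
  replace (eps / (4 * (M + 1)) * (4 * (M + 1)))%R with (pos eps) in H2
    by (field; lra).
  assert (Q : (Cmod (u - x, v - y)%R <= 2 * m)%R).
  { refine (Rle_trans _ _ _ (Cmod_le_re_im _) _); simpl.
    assert (A := Rmax_l (Rabs (u - x)) (Rabs (v - y))).
    assert (B := Rmax_r (Rabs (u - x)) (Rabs (v - y))). fold m in A, B; lra. }
  assert (E : (u, v) - (x, y) = (u - x, v - y)%R) by reflexivity.
  assert (B := HM (x, y) (u, v)).
  rewrite E in B; fold l in B.
  assert (Z : (Cmod ((x, y) - (x, y)) < r)%R)
    by (replace ((x, y) - (x, y)) with (RtoC 0) by ring; rewrite Cmod_0; exact Hr).
  refine (Rle_trans _ _ _ (B Z ltac:(lra)) _).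
  assert (Q0 := Cmod_ge_0 (u - x, v - y)%R).
  simpl pow; rewrite Rmult_1_r.
  apply Rle_trans with (M * ((2 * m) * (2 * m)))%R; [|nra].
  apply Rmult_le_compat_l; [exact M0|apply Rmult_le_compat; assumption]. }
split; intros eps; destruct (K eps) as [d Hd]; exists d; intros u v Hu Hv;
  refine (Rle_trans _ _ _ _ (Hd u v Hu Hv)).
- refine (Rle_trans _ _ _ _ (re_le_Cmod _)); apply Req_le; f_equal; simpl.
  unfold Re, Im; simpl; ring.
- refine (Rle_trans _ _ _ _ (im_le_Cmod _)); apply Req_le; f_equal; simpl.
  unfold Re, Im; simpl; ring.
Qed.

Lemma is_curve_derive_comp (f : C -> C) (g : R -> C) (t : R) (l : C) :
  has_quad_taylor f (g t) -> is_curve_derive g t l ->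
  is_curve_derive (fun x => f (g x)) t (C_derive f (g t) * l).
Proof.
intros H [H1 H2].
assert (E : g t = (Re (g t), Im (g t))) by (destruct (g t); reflexivity).
rewrite E in H; destruct (quad_taylor_differentiable _ _ _ H) as [D1 D2].
rewrite <- E in D1, D2.
apply is_derive_Reals in H1, H2.
split; apply is_derive_Reals.
- assert (D := derivable_pt_lim_comp_2d _ _ _ t _ _ _ _ D1 H1 H2).
  apply is_derive_Reals in D; apply is_derive_Reals.
  evar_last; [eapply is_derive_ext; [|exact D]|].
  + intros x; cbv beta; f_equal; f_equal; destruct (g x); reflexivity.
  + unfold Re, Im; simpl; ring.
- assert (D := derivable_pt_lim_comp_2d _ _ _ t _ _ _ _ D2 H1 H2).
  apply is_derive_Reals in D; apply is_derive_Reals.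
  evar_last; [eapply is_derive_ext; [|exact D]|].
  + intros x; cbv beta; f_equal; f_equal; destruct (g x); reflexivity.
  + unfold Re, Im; simpl; ring.
Qed.

(** * Complex-valued functions of a real variable and their integrals *)

Lemma curve_derive_continuous (g : R -> C) (t : R) (l : C) :
  is_curve_derive g t l -> curve_continuous g t.
Proof.
intros [H1 H2]; split; apply (ex_derive_continuous (K := R_AbsRing) (V := R_NormedModule));
  eexists; eassumption.
Qed.

Lemma is_curve_derive_mult_const (g : R -> C) (k : C) (t : R) (l : C) :
  is_curve_derive g t l -> is_curve_derive (fun x => g x * k) t (l * k).
Proof.
intros [H1 H2]; split.
- apply (is_derive_minus (V := R_NormedModule) _ _ _ _ _
    (is_derive_scal_l (V := R_NormedModule) _ t _ (Re k) H1)
    (is_derive_scal_l (V := R_NormedModule) _ t _ (Im k) H2)).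
- apply (is_derive_plus (V := R_NormedModule) _ _ _ _ _
    (is_derive_scal_l (V := R_NormedModule) _ t _ (Im k) H1)
    (is_derive_scal_l (V := R_NormedModule) _ t _ (Re k) H2)).
Qed.

Lemma curve_continuous_mult (g h : R -> C) (t : R) :
  curve_continuous g t -> curve_continuous h t ->
  curve_continuous (fun x => g x * h x) t.
Proof.
intros [G1 G2] [H1 H2]; split.
- apply (continuous_minus (V := R_NormedModule)
    (fun x => Re (g x) * Re (h x))%R (fun x => Im (g x) * Im (h x))%R);
  apply (continuous_mult (K := R_AbsRing)); assumption.
- apply (continuous_plus (V := R_NormedModule)
    (fun x => Re (g x) * Im (h x))%R (fun x => Im (g x) * Re (h x))%R);
  apply (continuous_mult (K := R_AbsRing)); assumption.
Qed.

Lemma curve_continuous_minus (g h : R -> C) (t : R) :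
  curve_continuous g t -> curve_continuous h t ->
  curve_continuous (fun x => g x - h x) t.
Proof.
intros [G1 G2] [H1 H2]; split.
- apply (continuous_minus (V := R_NormedModule)
    (fun x => Re (g x))%R (fun x => Re (h x))%R); assumption.
- apply (continuous_minus (V := R_NormedModule)
    (fun x => Im (g x))%R (fun x => Im (h x))%R); assumption.
Qed.

Lemma curve_continuous_const (k : C) (t : R) : curve_continuous (fun _ => k) t.
Proof. split; apply continuous_const. Qed.

Lemma curve_continuous_inv (g : R -> C) (t : R) :
  curve_continuous g t -> g t <> 0 -> curve_continuous (fun x => / g x) t.
Proof.
intros [G1 G2] N.
set (m := fun x => (Re (g x) ^ 2 + Im (g x) ^ 2)%R).
assert (Cm : continuous (fun x => / m x)%R t).
{ apply (continuous_comp m Rinv).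
  - assert (E : forall x, (Re (g x) * Re (g x) + Im (g x) * Im (g x))%R = m x)
      by (intros x; unfold m; ring).
    apply (continuous_ext _ _ _ E).
    apply (continuous_plus (V := R_NormedModule)
     (fun x => Re (g x) * Re (g x))%R (fun x => Im (g x) * Im (g x))%R);
    apply (continuous_mult (K := R_AbsRing)); assumption.
  - apply continuity_pt_filterlim, continuity_pt_inv; [apply continuity_pt_id|].
    unfold m, id; rewrite <- Cmod2_alt; apply pow_nonzero.
    intros E; apply N, Cmod_eq_0, E. }
split.
- apply (continuous_mult (K := R_AbsRing) (fun x => Re (g x)) (fun x => / m x)%R);
  assumption.
- apply (continuous_mult (K := R_AbsRing) (fun x => - Im (g x))%R (fun x => / m x)%R);
  [apply (continuous_opp (V := R_NormedModule) (fun x => Im (g x)))|]; assumption.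
Qed.

Definition cis (t : R) : C := (cos t, sin t).

Lemma Cmod_cis (t : R) : Cmod (cis t) = 1%R.
Proof.
unfold Cmod, cis; simpl fst; simpl snd.
replace (cos t ^ 2 + sin t ^ 2)%R with 1%R; [apply sqrt_1|].
generalize (sin2_cos2 t); unfold Rsqr; simpl; lra.
Qed.

Lemma is_curve_derive_cis (t : R) : is_curve_derive cis t (Ci * cis t).
Proof.
split; simpl; auto_derive; auto; ring.
Qed.

Lemma curve_continuous_cis (t : R) : curve_continuous cis t.
Proof. apply curve_derive_continuous with (1 := is_curve_derive_cis t). Qed.

Definition Cint (g : R -> C) (a b : R) : C :=
  (RInt (fun t => Re (g t)) a b, RInt (fun t => Im (g t)) a b).

Lemma Cint_ext (g h : R -> C) (a b : R) :
  (forall t, g t = h t) -> Cint g a b = Cint h a b.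
Proof.
intros H; unfold Cint; f_equal; apply RInt_ext; intros; rewrite H; reflexivity.
Qed.

Lemma ex_RInt_curve (g : R -> C) (a b : R) :
  (forall t, curve_continuous g t) ->
  ex_RInt (fun t => Re (g t)) a b /\ ex_RInt (fun t => Im (g t)) a b.
Proof.
intros H; split; apply (ex_RInt_continuous (V := R_CompleteNormedModule));
  intros t _; apply (H t).
Qed.

Lemma Cint_scal (k : C) (g : R -> C) (a b : R) :
  (forall t, curve_continuous g t) ->
  Cint (fun t => k * g t) a b = k * Cint g a b.
Proof.
intros H; destruct (ex_RInt_curve g a b H) as [E1 E2].
apply injective_projections; simpl.
- rewrite (RInt_minus (V := R_CompleteNormedModule)
     (fun t => Re k * Re (g t))%R (fun t => Im k * Im (g t))%R);
  try (apply (ex_RInt_scal (V := R_NormedModule)); assumption).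
  rewrite !(RInt_scal (V := R_CompleteNormedModule)) by assumption; reflexivity.
- rewrite (RInt_plus (V := R_CompleteNormedModule)
     (fun t => Re k * Im (g t))%R (fun t => Im k * Re (g t))%R);
  try (apply (ex_RInt_scal (V := R_NormedModule)); assumption).
  rewrite !(RInt_scal (V := R_CompleteNormedModule)) by assumption; reflexivity.
Qed.

Lemma Cint_minus (g h : R -> C) (a b : R) :
  (forall t, curve_continuous g t) -> (forall t, curve_continuous h t) ->
  Cint (fun t => g t - h t) a b = Cint g a b - Cint h a b.
Proof.
intros G H; destruct (ex_RInt_curve g a b G), (ex_RInt_curve h a b H).
apply injective_projections; simpl;
  apply (RInt_minus (V := R_CompleteNormedModule)); assumption.
Qed.

Lemma Cint_derive (g dg : R -> C) (a b : R) :
  (forall t, is_curve_derive g t (dg t)) -> (forall t, curve_continuous dg t) ->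
  Cint dg a b = g b - g a.
Proof.
intros H H'; apply injective_projections; simpl; apply is_RInt_unique.
- apply (is_RInt_derive (V := R_CompleteNormedModule) (fun t => Re (g t))
    (fun t => Re (dg t)));
  intros t _; [apply H|apply H'].
- apply (is_RInt_derive (V := R_CompleteNormedModule) (fun t => Im (g t))
    (fun t => Im (dg t)));
  intros t _; [apply H|apply H'].
Qed.

Lemma Cint_norm_le (g : R -> C) (a b M : R) :
  (a <= b)%R -> (forall t, curve_continuous g t) ->
  (forall t, (a <= t <= b)%R -> (Cmod (g t) <= M)%R) ->
  (Cmod (Cint g a b) <= 2 * (b - a) * M)%R.
Proof.
intros ab H HM; destruct (ex_RInt_curve g a b H) as [E1 E2].
refine (Rle_trans _ _ _ (Cmod_le_re_im _) _); simpl.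
assert (A := abs_RInt_le_const _ a b M ab E1
  (fun t Ht => Rle_trans _ _ _ (re_le_Cmod _) (HM t Ht))).
assert (B := abs_RInt_le_const _ a b M ab E2
  (fun t Ht => Rle_trans _ _ _ (im_le_Cmod _) (HM t Ht))).
lra.
Qed.

Lemma curve_bounded (g : R -> C) (a b : R) :
  (a <= b)%R -> (forall t, curve_continuous g t) ->
  exists M : R, forall t, (a <= t <= b)%R -> (Cmod (g t) <= M)%R.
Proof.
intros ab H.
assert (B : forall f : R -> R, (forall t, continuous f t) ->
  exists M : R, forall t, (a <= t <= b)%R -> (Rabs (f t) <= M)%R).
{ intros f Hf.
  destruct (continuity_ab_maj (fun t => Rabs (f t)) a b ab) as [x [Hx _]].
  - intros t _; apply continuity_pt_filterlim.
    apply (continuous_comp f Rabs); [apply Hf|apply continuous_Rabs].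
  - exists (Rabs (f x)); exact Hx. }
destruct (B _ (fun t => proj1 (H t))) as [M1 H1].
destruct (B _ (fun t => proj2 (H t))) as [M2 H2].
exists (M1 + M2)%R; intros t Ht.
refine (Rle_trans _ _ _ (Cmod_le_re_im _) _).
apply Rplus_le_compat; auto.
Qed.

(** * Cauchy's integral formula *)

Definition curve2_continuous (G : R -> R -> C) (s t : R) : Prop :=
  continuity_2d_pt (fun u v => Re (G u v)) s t /\
  continuity_2d_pt (fun u v => Im (G u v)) s t.

Lemma curve2_continuous_mult (G H : R -> R -> C) (s t : R) :
  curve2_continuous G s t -> curve2_continuous H s t ->
  curve2_continuous (fun u v => G u v * H u v) s t.
Proof.
intros [G1 G2] [H1 H2]; split.
- apply (continuity_2d_pt_minus (fun u v => Re (G u v) * Re (H u v))%R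
    (fun u v => Im (G u v) * Im (H u v))%R); apply continuity_2d_pt_mult; assumption.
- apply (continuity_2d_pt_plus (fun u v => Re (G u v) * Im (H u v))%R
    (fun u v => Im (G u v) * Re (H u v))%R); apply continuity_2d_pt_mult; assumption.
Qed.

Lemma curve2_continuous_derive_comp (f : C -> C) (G : R -> R -> C) (s t : R) :
  has_quad_taylor f (G s t) -> curve2_continuous G s t ->
  curve2_continuous (fun u v => C_derive f (G u v)) s t.
Proof.
intros H [G1 G2].
assert (K : forall eps : posreal, locally_2d
  (fun u v => Cmod (C_derive f (G u v) - C_derive f (G s t)) < eps)%R s t).
{ intros eps.
  destruct (quad_taylor_derive_continuous _ _ H eps (cond_pos eps)) as (d & Hd & D).
  assert (Hd2 : (0 < d / 2)%R) by lra.
  destruct (G1 (mkposreal _ Hd2)) as [d1 D1], (G2 (mkposreal _ Hd2)) as [d2 D2].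
  assert (Hm : (0 < Rmin d1 d2)%R) by (apply Rmin_glb_lt; apply cond_pos).
  exists (mkposreal _ Hm); simpl; intros u v Hu Hv; apply D.
  assert (L1 := Rmin_l d1 d2); assert (L2 := Rmin_r d1 d2).
  assert (A := D1 u v ltac:(lra) ltac:(lra)).
  assert (B := D2 u v ltac:(lra) ltac:(lra)); simpl in A, B.
  refine (Rle_lt_trans _ _ _ (Cmod_le_re_im _) _).
  change (Rabs (Re (G u v) - Re (G s t)) + Rabs (Im (G u v) - Im (G s t)) < d)%R.
  lra. }
split; intros eps; destruct (K eps) as [d D]; exists d; intros u v Hu Hv;
  refine (Rle_lt_trans _ _ _ _ (D u v Hu Hv)).
- refine (Rle_trans _ _ _ _ (re_le_Cmod _)); apply Req_le; reflexivity.
- refine (Rle_trans _ _ _ _ (im_le_Cmod _)); apply Req_le; reflexivity.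
Qed.

Lemma RInt_param_derive (F D : R -> R -> R) (a b s : R) :
  locally s (fun x => forall t, is_derive (fun y => F y t) x (D x t)) ->
  (forall t, continuity_2d_pt D s t) ->
  locally s (fun x => ex_RInt (F x) a b) ->
  is_derive (fun x => RInt (F x) a b) s (RInt (D s) a b).
Proof.
intros HD HC HI.
assert (E : RInt (D s) a b = RInt (fun t => Derive (fun u => F u t) s) a b).
{ apply RInt_ext; intros t _; symmetry; apply is_derive_unique.
  apply (locally_singleton _ _ HD). }
rewrite E; apply (is_derive_RInt_param F a b s).
- revert HD; apply filter_imp; intros x Hx t _; eexists; apply Hx.
- intros t _; apply continuity_2d_pt_ext_loc with (2 := HC t).
  destruct HD as [d Hd]; exists d; intros u v Hu _.
  symmetry; apply is_derive_unique, Hd, Hu.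
- exact HI.
Qed.

Lemma Cint_param_derive (F D : R -> R -> C) (a b s : R) :
  locally s (fun x => forall t, is_curve_derive (fun y => F y t) x (D x t)) ->
  (forall t, curve2_continuous D s t) ->
  locally s (fun x => forall t, curve_continuous (F x) t) ->
  is_curve_derive (fun x => Cint (F x) a b) s (Cint (D s) a b).
Proof.
intros HD HC HI; split.
- apply (RInt_param_derive (fun x t => Re (F x t)) (fun x t => Re (D x t))).
  + revert HD; apply filter_imp; intros x Hx t; apply Hx.
  + intros t; apply HC.
  + revert HI; apply filter_imp; intros x Hx; apply (ex_RInt_curve _ a b Hx).
- apply (RInt_param_derive (fun x t => Im (F x t)) (fun x t => Im (D x t))).
  + revert HD; apply filter_imp; intros x Hx t; apply Hx.
  + intros t; apply HC.
  + revert HI; apply filter_imp; intros x Hx; apply (ex_RInt_curve _ a b Hx).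
Qed.

(** Vanishing is asked at interior points only, since the contraction of a circle
    to a point degenerates at one endpoint; the mean value theorem on each
    component gives an interior point. *)
Lemma curve_derive_zero_const (g dg : R -> C) (a b : R) :
  (a < b)%R ->
  (forall s, (a <= s <= b)%R -> is_curve_derive g s (dg s)) ->
  (forall s, (a < s < b)%R -> dg s = 0) ->
  g a = g b.
Proof.
intros ab H Z; apply injective_projections.
- destruct (MVT_cor2 (fun s => Re (g s)) (fun s => Re (dg s)) a b ab) as (s & E & Hs).
  + intros s Hs; apply is_derive_Reals, H, Hs.
  + rewrite (Z s Hs) in E; unfold Re in E; simpl in E; lra.
- destruct (MVT_cor2 (fun s => Im (g s)) (fun s => Im (dg s)) a b ab) as (s & E & Hs).
  + intros s Hs; apply is_derive_Reals, H, Hs.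
  + rewrite (Z s Hs) in E; unfold Im in E; simpl in E; lra.
Qed.

(** For fixed [s], a circle; it shrinks from the circle of radius [rho] about [c]
    at [s = 1] to the point [c + h] at [s = 0]. *)
Definition pencil (c h : C) (rho s t : R) : C :=
  c + (1 - s) * h + s * rho * cis t.

Lemma pencil_derive_s (c h : C) (rho s t : R) :
  is_curve_derive (fun x => pencil c h rho x t) s (rho * cis t - h).
Proof.
split; unfold pencil, Re, Im; simpl; auto_derive; auto; ring.
Qed.

Lemma pencil_derive_t (c h : C) (rho s t : R) :
  is_curve_derive (pencil c h rho s) t (s * rho * (Ci * cis t)).
Proof.
split; unfold pencil, Re, Im; simpl; auto_derive; auto; ring.
Qed.

Lemma pencil_continuous (c h : C) (rho s t : R) :
  curve2_continuous (pencil c h rho) s t.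
Proof.
assert (A : forall (x y : R) (k : R -> R), continuity k -> continuity_2d_pt
   (fun u v => x + (1 - u) * y + u * rho * k v)%R s t).
{ intros x y k Hk.
  repeat apply continuity_2d_pt_plus; repeat apply continuity_2d_pt_mult;
  try apply continuity_2d_pt_minus;
  try apply continuity_2d_pt_const; try apply continuity_2d_pt_id1.
  apply (continuity_1d_2d_pt_comp k (fun _ v => v));
    [apply Hk|apply continuity_2d_pt_id2]. }
split.
- apply (continuity_2d_pt_ext (fun u v => Re c + (1 - u) * Re h + u * rho * cos v)%R).
  + intros; unfold pencil, Re; simpl; ring.
  + apply A, continuity_cos.
- apply (continuity_2d_pt_ext (fun u v => Im c + (1 - u) * Im h + u * rho * sin v)%R).
  + intros; unfold pencil, Im; simpl; ring.
  + apply A, continuity_sin.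
Qed.

Lemma curve2_continuous_cis (k : C) (s t : R) :
  curve2_continuous (fun _ v => k * cis v) s t.
Proof.
apply curve2_continuous_mult.
- split; apply continuity_2d_pt_const.
- split.
  + apply (continuity_1d_2d_pt_comp cos (fun _ v => v));
    [apply continuity_cos|apply continuity_2d_pt_id2].
  + apply (continuity_1d_2d_pt_comp sin (fun _ v => v));
    [apply continuity_sin|apply continuity_2d_pt_id2].
Qed.

Lemma circle_sub_neq_0 (h : C) (rho t : R) :
  (Cmod h < rho)%R -> rho * cis t - h <> 0.
Proof.
intros H E.
assert (E' : h = rho * cis t) by (rewrite <- (Cplus_0_r h), <- E; ring).
assert (P : (0 < rho)%R) by (generalize (Cmod_ge_0 h); lra).
rewrite E', Cmod_mult, Cmod_cis, Cmod_R, Rabs_pos_eq in H; lra.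
Qed.

(** With [z = c + rho cis t], [w = c + h], this is [(dz/dt) / (i (z - w))], the
    Cauchy kernel of the circle in the parameter [t]. *)
Definition cauchy_kernel (h : C) (rho t : R) : C :=
  rho * cis t * / (rho * cis t - h).

Lemma circle_continuous (rho t : R) : curve_continuous (fun x => rho * cis x) t.
Proof.
apply (curve_continuous_mult (fun _ => RtoC rho) cis);
  [apply curve_continuous_const|apply curve_continuous_cis].
Qed.

Lemma cauchy_kernel_continuous (h : C) (rho t : R) :
  (Cmod h < rho)%R -> curve_continuous (cauchy_kernel h rho) t.
Proof.
intros H.
apply (curve_continuous_mult (fun x => rho * cis x) (fun x => / (rho * cis x - h))).
- apply circle_continuous.
- apply (curve_continuous_inv (fun x => rho * cis x - h));
    [|apply circle_sub_neq_0, H].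
  apply (curve_continuous_minus (fun x => rho * cis x) (fun _ => h));
    [apply circle_continuous|apply curve_continuous_const].
Qed.

(** Contract the circle to the point [c + h] along [pencil].  The kernel cancels
    the factor produced by the [s]-derivative, so the derivative of the integral
    is the integral of [f'(pencil) * rho * cis t].  Up to the factor [s i] this
    integrand is the [t]-derivative of the closed curve [f(pencil)], hence it
    integrates to 0 and the integral does not depend on [s]. *)
Lemma cauchy_homotopy (f : C -> C) (c h : C) (rho R0 : R) :
  (Cmod h < rho)%R -> (rho < R0)%R ->
  (forall z, (Cmod (z - c) < R0)%R -> has_quad_taylor f z) ->
  Cint (fun t => f (c + h) * cauchy_kernel h rho t) 0 (2 * PI)
  = Cint (fun t => f (c + rho * cis t) * cauchy_kernel h rho t) 0 (2 * PI).
Proof.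
intros Hh Hrho Hf.
assert (h0 := Cmod_ge_0 h).
set (g := pencil c h rho).
set (F := fun s t => f (g s t) * cauchy_kernel h rho t).
set (D := fun s t => C_derive f (g s t) * (rho * cis t)).
(* [V s]: [f] is smooth along the circle of parameter [s].  This persists for
   [s] slightly outside [0, 1], as two-sided derivatives require. *)
set (V := fun s : R => forall t, has_quad_taylor f (g s t)).
assert (HV : forall s, (0 <= s <= 1)%R -> locally s V).
{ intros s Hs.
  assert (Hd : (0 < (R0 - rho) / (2 * rho))%R) by (apply Rdiv_lt_0_compat; lra).
  exists (mkposreal _ Hd); intros s' Hs' t; apply Hf.
  change (Rabs (s' - s) < (R0 - rho) / (2 * rho))%R in Hs'.
  apply (Rmult_lt_compat_r (2 * rho)) in Hs'; [|lra].
  replace ((R0 - rho) / (2 * rho) * (2 * rho))%R with (R0 - rho)%R in Hs'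
    by (field; lra).
  unfold g, pencil.
  replace (c + (1 - s') * h + s' * rho * cis t - c)
    with (RtoC (1 - s') * h + RtoC (s' * rho) * cis t)
    by (rewrite RtoC_minus, RtoC_mult; ring).
  refine (Rle_lt_trans _ _ _ (Cmod_triangle _ _) _).
  rewrite !Cmod_mult, !Cmod_R, Cmod_cis, Rabs_mult, (Rabs_pos_eq rho) by lra.
  assert (A1 : (Rabs (1 - s') <= (1 - s) + Rabs (s' - s))%R).
  { replace (1 - s')%R with ((1 - s) + - (s' - s))%R by ring.
    refine (Rle_trans _ _ _ (Rabs_triang _ _) _).
    rewrite Rabs_Ropp, (Rabs_pos_eq (1 - s)) by lra; lra. }
  assert (A2 : (Rabs s' <= s + Rabs (s' - s))%R).
  { replace s' with (s + (s' - s))%R at 1 by ring.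
    refine (Rle_trans _ _ _ (Rabs_triang _ _) _).
    rewrite (Rabs_pos_eq s) by lra; lra. }
  assert (B1 := Rabs_pos (1 - s')).
  assert (B2 := Rabs_pos s').
  nra. }
assert (HV0 : forall s, (0 <= s <= 1)%R -> V s)
  by (intros s Hs; exact (locally_singleton _ _ (HV s Hs))).
assert (fg_t : forall s t, V s ->
  is_curve_derive (fun x => f (g s x)) t (C_derive f (g s t) * (s * rho * (Ci * cis t)))).
{ intros s t Hs; apply (is_curve_derive_comp f (g s)); [apply Hs|].
  apply pencil_derive_t. }
assert (D_cont : forall s t, V s -> curve2_continuous D s t).
{ intros s t Hs; apply curve2_continuous_mult; [|apply curve2_continuous_cis].
  apply curve2_continuous_derive_comp; [apply Hs|apply pencil_continuous]. }
assert (D_cont1 : forall s t, V s -> curve_continuous (D s) t).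
{ intros s t Hs; destruct (D_cont s t Hs) as [D1 D2].
  split; intros P [eps HP].
  - destruct (D1 eps) as [d Hd]; exists d; intros y Hy; apply HP, Hd; [|exact Hy].
    replace (s - s)%R with 0%R by ring; rewrite Rabs_R0; apply cond_pos.
  - destruct (D2 eps) as [d Hd]; exists d; intros y Hy; apply HP, Hd; [|exact Hy].
    replace (s - s)%R with 0%R by ring; rewrite Rabs_R0; apply cond_pos. }
assert (K := curve_derive_zero_const (fun s => Cint (F s) 0 (2 * PI))
  (fun s => Cint (D s) 0 (2 * PI)) 0 1 Rlt_0_1).
assert (F0 : forall t, F 0%R t = f (c + h) * cauchy_kernel h rho t).
{ intros t; unfold F, g, pencil; do 2 f_equal; ring. }
assert (F1 : forall t, F 1%R t = f (c + rho * cis t) * cauchy_kernel h rho t).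
{ intros t; unfold F, g, pencil; do 2 f_equal; ring. }
rewrite <- (Cint_ext _ _ _ _ F0), <- (Cint_ext _ _ _ _ F1).
apply K; clear K F0 F1.
- intros s Hs; apply Cint_param_derive.
  + generalize (HV s Hs); apply filter_imp; intros x Hx t.
    replace (D x t)
      with (C_derive f (g x t) * (rho * cis t - h) * cauchy_kernel h rho t).
    * apply is_curve_derive_mult_const.
      apply (is_curve_derive_comp f (fun y => g y t)); [apply Hx|].
      apply pencil_derive_s.
    * unfold D, cauchy_kernel; field; apply circle_sub_neq_0, Hh.
  + intros t; apply D_cont, HV0, Hs.
  + generalize (HV s Hs); apply filter_imp; intros x Hx t.
    apply (curve_continuous_mult (fun y => f (g x y))).
    * apply curve_derive_continuous with (1 := fg_t x t Hx).
    * apply cauchy_kernel_continuous, Hh.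
- intros s Hs.
  assert (Vs : V s) by (apply HV0; lra).
  assert (Hc : s * Ci <> 0).
  { apply Cmult_neq_0; [intros E; apply RtoC_inj in E; lra|].
    intros E; apply (f_equal Cmod) in E; rewrite Cmod_Ci, Cmod_0 in E; lra. }
  assert (Z : s * Ci * Cint (D s) 0 (2 * PI) = 0).
  { rewrite <- Cint_scal by (intros t; apply D_cont1, Vs).
    rewrite (Cint_derive (fun t => f (g s t))).
    - assert (E : g s (2 * PI)%R = g s 0%R).
      { unfold g, pencil, cis; rewrite cos_2PI, sin_2PI, cos_0, sin_0; reflexivity. }
      rewrite E; ring.
    - intros t.
      replace (s * Ci * D s t) with (C_derive f (g s t) * (s * rho * (Ci * cis t)))
        by (unfold D; ring).
      apply fg_t, Vs.
    - intros t; apply (curve_continuous_mult (fun _ => s * Ci));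
        [apply curve_continuous_const|apply D_cont1, Vs]. }
  replace (Cint (D s) 0 (2 * PI))
    with (/ (s * Ci) * (s * Ci * Cint (D s) 0 (2 * PI))) by (field; split;
      intros E; apply Hc; rewrite E; ring).
  rewrite Z; ring.
Qed.

(** * Taylor expansion on a disc *)

Lemma curve_continuous_pow (g : R -> C) (n : nat) (t : R) :
  curve_continuous g t -> curve_continuous (fun x => g x ^ n) t.
Proof.
intros H; induction n as [|n IH]; [apply (curve_continuous_const 1)|].
exact (curve_continuous_mult g _ t H IH).
Qed.

(** Up to the factor [2 PI], the Taylor coefficients given by Cauchy's formula
    when [g] is the restriction of the function to the circle. *)
Definition cauchy_moment (g : R -> C) (rho : R) (n : nat) : C :=
  Cint (fun t => g t * (/ (rho * cis t)) ^ n) 0 (2 * PI).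

Lemma circle_neq_0 (rho t : R) : (0 < rho)%R -> rho * cis t <> 0.
Proof.
intros H; replace (rho * cis t) with (rho * cis t - 0) by ring.
apply circle_sub_neq_0; rewrite Cmod_0; exact H.
Qed.

Lemma inv_circle_continuous (rho t : R) :
  (0 < rho)%R -> curve_continuous (fun x => / (rho * cis x)) t.
Proof.
intros H; apply (curve_continuous_inv (fun x => rho * cis x));
  [apply circle_continuous|apply circle_neq_0, H].
Qed.

Lemma moment_integrand_continuous (g : R -> C) (rho : R) (n : nat) (t : R) :
  (0 < rho)%R -> curve_continuous g t ->
  curve_continuous (fun x => g x * (/ (rho * cis x)) ^ n) t.
Proof.
intros H G; apply (curve_continuous_mult g); [exact G|].
apply (curve_continuous_pow (fun x => / (rho * cis x))), inv_circle_continuous, H.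
Qed.

Lemma Cmod_inv_circle_pow (rho t : R) (n : nat) :
  (0 < rho)%R -> Cmod ((/ (rho * cis t)) ^ n) = (/ rho ^ n)%R.
Proof.
intros H; rewrite Cmod_pow, Cmod_inv by (apply circle_neq_0, H).
rewrite Cmod_mult, Cmod_cis, Cmod_R, Rabs_pos_eq, Rmult_1_r by lra.
apply pow_inv.
Qed.

Lemma moment_norm_le (g : R -> C) (rho M : R) (n : nat) :
  (0 < rho)%R -> (forall t, curve_continuous g t) ->
  (forall t, (0 <= t <= 2 * PI)%R -> (Cmod (g t) <= M)%R) ->
  (Cmod (cauchy_moment g rho n) <= 2 * (2 * PI) * M / rho ^ n)%R.
Proof.
intros H G HM; assert (P := PI_RGT_0).
assert (Pn : (0 < / rho ^ n)%R) by (apply Rinv_0_lt_compat, pow_lt, H).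
replace (2 * (2 * PI) * M / rho ^ n)%R
  with (2 * (2 * PI - 0) * (M * / rho ^ n))%R by (unfold Rdiv; ring).
apply Cint_norm_le; [lra|intros; apply moment_integrand_continuous; auto|].
intros t Ht; rewrite Cmod_mult, Cmod_inv_circle_pow by exact H.
apply Rmult_le_compat_r; [lra|auto].
Qed.

(** Expand the kernel as a geometric series in [h / (rho cis t)].  Its exact
    remainder after each partial sum is again a moment, of size
    [(|h| / rho)^n], so no exchange of limit and integral is needed. *)
Lemma cauchy_kernel_series (g : R -> C) (h : C) (rho : R) :
  (Cmod h < rho)%R -> (forall t, curve_continuous g t) ->
  Cis_series (fun n => cauchy_moment g rho n * h ^ n)
    (Cint (fun t => g t * cauchy_kernel h rho t) 0 (2 * PI)).
Proof.
intros Hh G.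
assert (h0 := Cmod_ge_0 h).
assert (Hr : (0 < rho)%R) by lra.
set (k := fun t => g t * cauchy_kernel h rho t).
assert (Kc : forall t, curve_continuous k t).
{ intros t; apply (curve_continuous_mult g); [apply G|].
  apply cauchy_kernel_continuous, Hh. }
(* Each term of the series lowers the remainder by one step, because
   k(t) (1 - h / zeta) = g(t) on the circle. *)
assert (step : forall n, cauchy_moment k rho n * h ^ n
  - cauchy_moment k rho (S n) * h ^ S n = cauchy_moment g rho n * h ^ n).
{ intros n; unfold cauchy_moment.
  rewrite !(Cmult_comm _ (h ^ _)).
  rewrite <- !Cint_scal by (intros t; apply moment_integrand_continuous; auto).
  rewrite <- Cint_minus.
  - apply Cint_ext; intros t; unfold k, cauchy_kernel; rewrite !Cpow_S.
    assert (N := circle_neq_0 rho t Hr).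
    field; repeat split; try (apply circle_sub_neq_0, Hh);
      intros E; apply N; rewrite E; ring.
  - intros t; apply (curve_continuous_mult (fun _ => h ^ n));
      [apply curve_continuous_const|apply moment_integrand_continuous; auto].
  - intros t; apply (curve_continuous_mult (fun _ => h ^ S n));
      [apply curve_continuous_const|apply moment_integrand_continuous; auto]. }
assert (sum : forall n, Csum_n (fun n => cauchy_moment g rho n * h ^ n) n
  = Cint k 0 (2 * PI) - cauchy_moment k rho (S n) * h ^ S n).
{ induction n as [|n IH].
  - rewrite Csum_n_0, <- step; f_equal.
    unfold cauchy_moment; simpl Cpow; rewrite Cmult_1_r.
    apply Cint_ext; intros t; ring.
  - rewrite Csum_n_S, IH, <- step; ring. }
destruct (curve_bounded k 0 (2 * PI)) as [M HM];
  [generalize PI_RGT_0; lra|exact Kc|].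
apply Cis_series_lim.
assert (L : is_lim_seq (fun n => 2 * (2 * PI) * M * (Cmod h / rho) ^ S n)%R 0).
{ replace 0%R with (2 * (2 * PI) * M * 0)%R by ring.
  apply (is_lim_seq_scal_l _ (2 * (2 * PI) * M)%R 0%R).
  apply (is_lim_seq_incr_1 (fun n => (Cmod h / rho) ^ n)%R), is_lim_seq_geom.
  rewrite Rabs_pos_eq.
  - apply Rmult_lt_reg_r with rho; [exact Hr|].
    unfold Rdiv; rewrite Rmult_assoc, Rinv_l by lra; lra.
  - apply Rdiv_le_0_compat; lra. }
refine (is_lim_seq_le_le _ _ _ _ _ (is_lim_seq_const 0) L).
intros n; split; [apply Cmod_ge_0|].
rewrite sum.
replace (Cint k 0 (2 * PI) - cauchy_moment k rho (S n) * h ^ S n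
   - Cint k 0 (2 * PI))
  with (- (cauchy_moment k rho (S n) * h ^ S n)) by ring.
rewrite Cmod_opp, Cmod_mult, Cmod_pow.
refine (Rle_trans _ _ _ (Rmult_le_compat_r _ _ _ _
  (moment_norm_le k rho M (S n) Hr Kc HM)) _); [apply pow_le, h0|].
apply Req_le; unfold Rdiv; rewrite Rpow_mult_distr, pow_inv; ring.
Qed.

Lemma cis_add (x y : R) : cis (x + y) = cis x * cis y.
Proof.
unfold cis; rewrite cos_plus, sin_plus.
apply injective_projections; simpl; ring.
Qed.

Lemma inv_circle_pow (rho t : R) (n : nat) :
  (0 < rho)%R -> (/ (rho * cis t)) ^ n = / rho ^ n * cis (- INR n * t).
Proof.
intros H.
assert (N := circle_neq_0 rho t H).
assert (r0 : RtoC rho <> 0) by (intros E; apply RtoC_inj in E; lra).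
assert (c0 : cis t <> 0) by (intros E; apply N; rewrite E; ring).
induction n as [|n IH].
- simpl; replace (- 0 * t)%R with 0%R by ring.
  unfold cis; rewrite cos_0, sin_0; change (1%R, 0%R) with (RtoC 1).
  field; intros E; apply RtoC_inj in E; lra.
- rewrite !Cpow_S, IH.
  assert (E : cis (- INR n * t) = cis t * cis (- INR (S n) * t)).
  { rewrite <- cis_add, S_INR; f_equal; ring. }
  rewrite E; field; repeat split; auto using Cpow_nz.
Qed.

Lemma moment_one_S (rho : R) (n : nat) :
  (0 < rho)%R -> cauchy_moment (fun _ => 1) rho (S n) = 0.
Proof.
intros H; unfold cauchy_moment.
set (N := (- INR (S n))%R).
assert (N0 : N <> 0%R)
  by (unfold N; rewrite S_INR; generalize (pos_INR n); lra).
set (k := RtoC N * Ci).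
assert (k0 : k <> 0).
{ apply Cmult_neq_0; [intros E; apply RtoC_inj in E; lra|].
  intros E; apply (f_equal Cmod) in E; rewrite Cmod_Ci, Cmod_0 in E; lra. }
assert (Cc : forall t, is_curve_derive (fun x => cis (N * x)) t (k * cis (N * t))).
{ intros t; split; unfold k, Re, Im; simpl; auto_derive; auto; ring. }
transitivity (Cint (fun t => (/ rho ^ S n * / k) * (k * cis (N * t))) 0 (2 * PI)).
{ apply Cint_ext; intros t; rewrite inv_circle_pow by exact H; fold N.
  field; split; [exact k0|].
  apply Cpow_nz; intros E; apply RtoC_inj in E; lra. }
assert (Cd : forall t, curve_continuous (fun t => k * cis (N * t)) t).
{ intros t; apply (curve_continuous_mult (fun _ => k));
    [apply curve_continuous_const|apply curve_derive_continuous with (1 := Cc t)]. }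
rewrite Cint_scal by exact Cd.
rewrite (Cint_derive _ _ _ _ Cc Cd).
replace (cis (N * (2 * PI))) with (cis (N * 0)); [ring|].
unfold cis, N; f_equal.
- replace (- INR (S n) * (2 * PI))%R with (- (0 + 2 * INR (S n) * PI))%R by ring.
  rewrite cos_neg, cos_period; f_equal; ring.
- replace (- INR (S n) * (2 * PI))%R with (- (0 + 2 * INR (S n) * PI))%R by ring.
  rewrite sin_neg, sin_period, <- sin_neg; f_equal; ring.
Qed.

Lemma Cis_series_single (x : C) (u : nat -> C) :
  u O = x -> (forall n, u (S n) = 0) -> Cis_series u x.
Proof.
intros H0 HS; apply Cis_series_lim.
apply is_lim_seq_ext with (fun _ => 0%R); [|apply is_lim_seq_const].
intros n; replace (Csum_n u n) with x.
- replace (x - x) with (RtoC 0) by ring; rewrite Cmod_0; reflexivity.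
- induction n as [|n IH]; [rewrite Csum_n_0; auto|].
  rewrite Csum_n_S, <- IH, HS; ring.
Qed.

(** The kernel expansion for [g = 1], where only the moment of order 0 survives. *)
Lemma Cint_cauchy_kernel (h : C) (rho : R) :
  (Cmod h < rho)%R -> Cint (cauchy_kernel h rho) 0 (2 * PI) = RtoC (2 * PI).
Proof.
intros Hh.
assert (Hr : (0 < rho)%R) by (generalize (Cmod_ge_0 h); lra).
assert (S := cauchy_kernel_series (fun _ => 1) h rho Hh
               (fun t => curve_continuous_const 1 t)).
apply (Cis_series_unique _ _ (RtoC (2 * PI))) in S.
- rewrite <- S; apply Cint_ext; intros t; ring.
- apply Cis_series_single.
  + simpl Cpow; rewrite Cmult_1_r; unfold cauchy_moment.
    rewrite (Cint_ext _ (fun _ => 1)) by (intros t; simpl; ring).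
    rewrite (Cint_derive RtoC); [ring| |intros t; apply curve_continuous_const].
    intros t; split; unfold Re, Im; simpl; auto_derive; auto; ring.
  + intros n; rewrite moment_one_S by exact Hr; ring.
Qed.

(** Local power series at all points of a disc patch together to one power series
    about its centre, by Cauchy's integral formula.  The coefficient bound is
    Cauchy's estimate on the circle of radius [rho]. *)
Lemma analytic_disc_taylor (f : C -> C) (c : C) (rho R0 : R) :
  (0 < rho < R0)%R -> analytic_in_disc f c R0 ->
  exists (a : nat -> C) (M : R),
    (forall n, (Cmod (a n) <= M / rho ^ n)%R) /\
    forall h, (Cmod h < rho)%R -> Cis_series (fun n => a n * h ^ n) (f (c + h)).
Proof.
intros Hrho Hf.
assert (Hq : forall z, (Cmod (z - c) < R0)%R -> has_quad_taylor f z)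
  by (intros z Hz; apply analytic_quad_taylor, Hf, Hz).
set (g := fun t => f (c + rho * cis t)).
assert (P := PI_RGT_0).
assert (G : forall t, curve_continuous g t).
{ intros t.
  apply curve_derive_continuous with
    (C_derive f (c + rho * cis t) * (rho * (Ci * cis t))).
  apply (is_curve_derive_comp f (fun x => c + rho * cis x)).
  - apply Hq; replace (c + rho * cis t - c) with (rho * cis t) by ring.
    rewrite Cmod_mult, Cmod_cis, Cmod_R, Rabs_pos_eq; lra.
  - split; unfold Re, Im; simpl; auto_derive; auto; ring. }
destruct (curve_bounded g 0 (2 * PI)) as [M HM]; [lra|exact G|].
exists (fun n => / RtoC (2 * PI) * cauchy_moment g rho n), (2 * M)%R.
assert (N : RtoC (2 * PI) <> 0) by (intros E; apply RtoC_inj in E; lra).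
split.
- intros n; rewrite Cmod_mult, Cmod_inv, Cmod_R, Rabs_pos_eq by (exact N || lra).
  apply Rmult_le_reg_l with (2 * PI)%R; [lra|].
  rewrite <- Rmult_assoc, Rinv_r, Rmult_1_l by lra.
  refine (Rle_trans _ _ _ (moment_norm_le g rho M n (proj1 Hrho) G HM) _).
  apply Req_le; unfold Rdiv; ring.
- intros h Hh.
  apply Cis_series_ext with
    (fun n => / RtoC (2 * PI) * (cauchy_moment g rho n * h ^ n)).
  { intros n; ring. }
  replace (f (c + h)) with (/ RtoC (2 * PI) * (Cint (fun t => g t
     * cauchy_kernel h rho t) 0 (2 * PI))).
  + apply Cis_series_scal, cauchy_kernel_series; assumption.
  + unfold g; rewrite <- (cauchy_homotopy f c h rho R0 Hh (proj2 Hrho) Hq).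
    rewrite Cint_scal by (intros t; apply cauchy_kernel_continuous, Hh).
    rewrite Cint_cauchy_kernel by exact Hh; field; exact N.
Qed.

(** * Derivatives at real points and the two iterated series *)

(** [C_derive] takes its limit along the real direction, so at a real point it
    only sees the restriction to the real line, differentiable or not. *)
Lemma C_derive_real (f : C -> C) (x : R) :
  C_derive f x = (Derive (fun y : R => Re (f y)) x, Derive (fun y : R => Im (f y)) x).
Proof.
assert (N : forall n : nat, (/ (INR n + 1))%R <> 0%R).
{ intros n; apply Rinv_neq_0_compat; generalize (pos_INR n); lra. }
unfold C_derive, C_lim, Derive, Lim; simpl fst; simpl snd.
f_equal; (erewrite Lim_seq_ext; [reflexivity|]); intros n; unfold Rbar_loc_seq;
  specialize (N n); rewrite (Rplus_0_l (/ (INR n + 1)));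
  unfold RtoC, Re, Im; set (h := (/ (INR n + 1))%R) in *;
  destruct (f ((x + h)%R, 0%R)) as [u v]; destruct (f (x, 0%R)) as [u' v'];
  simpl; field; repeat split; intros E; apply N; nra.
Qed.

Lemma Cderive_n_real (f : C -> C) (k : nat) (x : R) :
  Cderive_n f k x
  = (Derive_n (fun y : R => Re (f y)) k x, Derive_n (fun y : R => Im (f y)) k x).
Proof.
revert x; induction k as [|k IH]; intros x.
- simpl; destruct (f x); reflexivity.
- change (Cderive_n f (S k) x) with (C_derive (Cderive_n f k) x).
  rewrite C_derive_real; f_equal; simpl; apply Derive_ext; intros y;
    rewrite IH; reflexivity.
Qed.

Lemma real_taylor_derive_n (u : R -> R) (A : nat -> R) (c rho M : R) (k : nat) (x : R) :
  (forall n, (Rabs (A n) <= M / rho ^ n)%R) ->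
  (forall y, (Rabs y < rho)%R -> is_series (fun n => A n * y ^ n)%R (u (c + y)%R)) ->
  (Rabs (x - c) < rho)%R ->
  is_series (fun m => PS_derive_n k A m * (x - c) ^ m)%R
    (Derive_n u k x).
Proof.
intros HA Hu Hx.
assert (Hr : (0 < rho)%R) by (generalize (Rabs_pos (x - c)); lra).
assert (CV : Rbar_le rho (CV_radius A)).
{ apply (proj1 (CV_radius_bounded A)); exists M; intros n.
  rewrite Rabs_mult, <- RPow_abs, (Rabs_pos_eq rho) by lra.
  assert (P : (0 < rho ^ n)%R) by (apply pow_lt; lra).
  apply Rmult_le_reg_r with (/ rho ^ n)%R; [apply Rinv_0_lt_compat, P|].
  rewrite Rmult_assoc, Rinv_r, Rmult_1_r by lra; apply HA. }
assert (CVx : Rbar_lt (Rabs (x - c)) (CV_radius A))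
  by (apply Rbar_lt_le_trans with rho; [exact Hx|exact CV]).
assert (E : Derive_n u k x = PSeries (PS_derive_n k A) (x - c)).
{ rewrite <- (Derive_n_PSeries k A (x - c) CVx).
  change (x - c)%R with (x + - c)%R.
  rewrite <- (Derive_n_comp_trans (PSeries A) k x (- c)).
  apply Derive_n_ext_loc.
  assert (Hd : (0 < rho - Rabs (x - c))%R) by lra.
  exists (mkposreal _ Hd); intros y Hy.
  change (Rabs (y - x) < rho - Rabs (x - c))%R in Hy.
  assert (T := Rabs_triang (y - x) (x - c)).
  replace (y - x + (x - c))%R with (y - c)%R in T by ring.
  replace (y + - c)%R with (y - c)%R by ring.
  symmetry; apply is_pseries_unique, is_pseries_R.
  assert (H := Hu (y - c)%R ltac:(lra)).
  assert (Ey : (c + (y - c))%R = y) by apply Rplus_minus.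
  rewrite Ey in H; exact H. }
rewrite E.
apply (proj1 (is_pseries_R (PS_derive_n k A) (x - c) _)), PSeries_correct, CV_radius_inside.
rewrite CV_radius_derive_n; exact CVx.
Qed.

(** On the real diameter the Taylor series is a pair of real power series, whose
    derivatives are computed termwise. *)
Lemma analytic_disc_taylor_derive_n (f : C -> C) (c rho R0 : R) :
  (0 < rho < R0)%R -> analytic_in_disc f c R0 ->
  exists (a : nat -> C) (M : R),
    (forall n, (Cmod (a n) <= M / rho ^ n)%R) /\
    forall (k : nat) (x : R), (Rabs (x - c) < rho)%R ->
      Cis_series (fun m => RtoC (INR (fact (m + k)) / INR (fact m)) * a (m + k)%nat
                           * RtoC (x - c) ^ m)
        (Cderive_n f k x).
Proof.
intros Hrho Hf; destruct (analytic_disc_taylor f c rho R0 Hrho Hf) as (a & M & Ha & Hs).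
assert (ER : forall (z : C) (y : R) n, Re (z * RtoC y ^ n) = (Re z * y ^ n)%R).
{ intros z y n; rewrite <- RtoC_pow; unfold Re; simpl; ring. }
assert (EI : forall (z : C) (y : R) n, Im (z * RtoC y ^ n) = (Im z * y ^ n)%R).
{ intros z y n; rewrite <- RtoC_pow; unfold Im; simpl; ring. }
exists a, M; split; [exact Ha|]; intros k x Hx.
rewrite Cderive_n_real; apply Cis_series_Re_Im; split.
- eapply is_series_ext; [|apply (real_taylor_derive_n (fun y : R => Re (f y))
    (fun n => Re (a n)) c rho M k x); [|intros y Hy|exact Hx]].
  + intros m; unfold PS_derive_n; rewrite ER; unfold Re; simpl; ring.
  + intros n; exact (Rle_trans _ _ _ (re_le_Cmod _) (Ha n)).
  + assert (H := Hs y ltac:(rewrite Cmod_R; exact Hy)).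
    apply Cis_series_Re_Im in H; destruct H as [H _].
    rewrite RtoC_plus; revert H; apply is_series_ext; intros n; apply ER.
- eapply is_series_ext; [|apply (real_taylor_derive_n (fun y : R => Im (f y))
    (fun n => Im (a n)) c rho M k x); [|intros y Hy|exact Hx]].
  + intros m; unfold PS_derive_n; rewrite EI; unfold Im; simpl; ring.
  + intros n; exact (Rle_trans _ _ _ (im_le_Cmod _) (Ha n)).
  + assert (H := Hs y ltac:(rewrite Cmod_R; exact Hy)).
    apply Cis_series_Re_Im in H; destruct H as [_ H].
    rewrite RtoC_plus; revert H; apply is_series_ext; intros n; apply EI.
Qed.

Lemma Cpoch_neg_fact (k m : nat) :
  Cpoch (- INR (k + m)) k * INR (fact m) = (- (1)) ^ k * INR (fact (k + m)).
Proof.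
induction k as [|k IH]; [simpl; ring|].
rewrite Cpoch_shift, Cpow_S; simpl (S k + m)%nat.
replace (- INR (S (k + m)) + 1) with (- INR (k + m)) by (rewrite INR_C_S; ring).
rewrite fact_C_S.
transitivity (- INR (S (k + m)) * (Cpoch (- INR (k + m)) k * INR (fact m)));
  [ring|rewrite IH; ring].
Qed.

Lemma m1_pow_double (n : nat) : (- (1)) ^ (2 * n) = 1.
Proof.
rewrite Cpow_mult_r; replace ((- (1)) ^ 2) with (RtoC 1) by (simpl; ring).
apply Cpow_1_l.
Qed.

(** Since [(-n)_k = (-1)^k n! / (n-k)!], the inner series over [n] is the
    Taylor series about 1 of the [k]-th derivative, taken at 0. *)
Lemma inner_term_taylor (f : C -> C) (c : nat -> C) (k m : nat) :
  (forall n, Cderive_n f n 1 = INR (fact n) * c n) ->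
  inner_term f k m
  = RtoC (INR (fact (m + k)) / INR (fact m)) * c (m + k)%nat * RtoC (- (1)) ^ m.
Proof.
intros D; unfold inner_term; rewrite D, (Nat.add_comm m k).
assert (Fm := fact_C_neq_0 m); assert (Fn := fact_C_neq_0 (k + m)).
assert (E := Cpoch_neg_fact k m).
rewrite RtoC_div, RtoC_opp by apply INR_fact_neq_0.
replace (Cpoch (- INR (k + m)) k)
  with ((- (1)) ^ k * INR (fact (k + m)) / INR (fact m))
  by (rewrite <- E; field; exact Fm).
rewrite Cpow_add_r.
transitivity ((- (1)) ^ (2 * k) * (INR (fact (k + m)) / INR (fact m)
   * c (k + m)%nat * (- (1)) ^ m)).
- replace (2 * k)%nat with (k + k)%nat by lia; rewrite Cpow_add_r; field.
  split; assumption.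
- rewrite m1_pow_double; ring.
Qed.

Lemma Cis_series_pairs (u : nat -> C) (l : C) :
  Cis_series u l -> Cis_series (fun j => u (2 * j)%nat + u (S (2 * j))) l.
Proof.
intros H; apply Cis_series_lim in H; apply Cis_series_lim.
apply is_lim_seq_ext with
  (fun j => (fun n => Cmod (Csum_n u n - l)) (S (2 * j))).
- intros j; cbv beta; do 2 f_equal.
  induction j as [|j IH]; [rewrite Csum_n_S, !Csum_n_0; reflexivity|].
  rewrite (Csum_n_S (fun j => u (2 * j)%nat + u (S (2 * j))) j), <- IH.
  replace (2 * S j)%nat with (S (S (2 * j))) by lia.
  rewrite (Csum_n_S u (S (S (2 * j)))), (Csum_n_S u (S (2 * j))); ring.
- apply (is_lim_seq_subseq (fun n => Cmod (Csum_n u n - l)) 0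
    (fun j => S (2 * j))); [|exact H].
  apply eventually_subseq; intros n; lia.
Qed.

Lemma kummer_sum_ratio_lim (a : C) :
  is_lim_seq (fun j => Cmod (2 * a + 1 + 2 * INR j) / (2 * INR j + 1))%R 1.
Proof.
assert (L : is_lim_seq (fun j => Cmod (2 * a) * / (2 * INR j + 1))%R 0).
{ replace (Finite 0) with (Rbar_mult (Cmod (2 * a)) 0) by (simpl; f_equal; ring).
  apply is_lim_seq_scal_l.
  replace (Finite 0) with (Rbar_inv p_infty) by reflexivity.
  apply is_lim_seq_inv; [|discriminate].
  apply is_lim_seq_ext with (fun j => INR (S (2 * j))).
  - intros j; rewrite S_INR, mult_INR; simpl; ring.
  - apply (is_lim_seq_subseq INR p_infty (fun j => S (2 * j)));
      [|apply is_lim_seq_INR].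
    apply eventually_subseq; intros n; lia. }
assert (L1 := is_lim_seq_minus' _ _ _ _ (is_lim_seq_const 1) L).
assert (L2 := is_lim_seq_plus' _ _ _ _ (is_lim_seq_const 1) L).
rewrite Rminus_0_r in L1; rewrite Rplus_0_r in L2.
refine (is_lim_seq_le_le _ _ _ _ _ L1 L2); intros j.
assert (J := pos_INR j); set (n := (2 * INR j + 1)%R).
assert (Hn : (0 < n)%R) by (unfold n; lra).
replace (2 * a + 1 + 2 * INR j) with (2 * a + RtoC n)
  by (unfold n; rewrite RtoC_plus, RtoC_mult; ring).
assert (T := Cmod_triangle (2 * a) n).
assert (T2 := Cmod_triangle (2 * a + n) (- (2 * a))).
replace (2 * a + n + - (2 * a)) with (RtoC n) in T2 by ring.
rewrite Cmod_opp in T2; rewrite Cmod_R, Rabs_pos_eq in T, T2 by lra.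
split; apply Rmult_le_reg_r with n; try exact Hn; unfold Rdiv;
  rewrite ?Rmult_minus_distr_r, ?Rmult_plus_distr_r, !Rmult_assoc, Rinv_l by lra; lra.
Qed.

Lemma kummer_sum_even_neq_0 (a : C) (j : nat) :
  ~ nonpos_integer (2 * a + 1) -> kummer_sum a (2 * j) <> 0.
Proof.
intros ha E; apply (fact_C_neq_0 (2 * j)).
rewrite <- (kummer_sum_even_closed a j ha), E; ring.
Qed.

(** The ratio of consecutive even-indexed values is [(2j+1) / (2a+1+2j)], which
    tends to 1. *)
Lemma kummer_sum_even_summable (a : C) (q : R) :
  ~ nonpos_integer (2 * a + 1) -> (0 < q < 1)%R ->
  ex_series (fun j => Cmod (kummer_sum a (2 * j)) * q ^ j)%R.
Proof.
intros ha Hq.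
assert (P : forall j, (0 < Cmod (kummer_sum a (2 * j)) * q ^ j)%R).
{ intros j; apply Rmult_lt_0_compat; [|apply pow_lt; lra].
  apply Cmod_gt_0, kummer_sum_even_neq_0, ha. }
apply ex_series_ext with
  (fun j => Rabs (Cmod (kummer_sum a (2 * j)) * q ^ j)%R).
{ intros j; apply Rabs_pos_eq, Rlt_le, P. }
apply (ex_series_DAlembert _ q); [lra|intros j; generalize (P j); lra|].
apply is_lim_seq_ext with
  (fun j => q * / (Cmod (2 * a + 1 + 2 * INR j) / (2 * INR j + 1)))%R.
- intros j; assert (J := pos_INR j).
  assert (N1 : (Cmod (kummer_sum a (2 * j)) <> 0)%R).
  { intros E; apply Cmod_eq_0 in E; exact (kummer_sum_even_neq_0 a j ha E). }
  assert (N2 : 2 * a + 1 + 2 * INR j <> 0).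
  { rewrite <- INR_C_double; apply add_INR_neq_0, ha. }
  assert (N3 : (Cmod (2 * a + 1 + 2 * INR j) <> 0)%R)
    by (intros E; apply Cmod_eq_0 in E; exact (N2 E)).
  assert (Nq : (q ^ j <> 0)%R) by (apply pow_nonzero; lra).
  assert (R : (Cmod (kummer_sum a (2 * S j)) * Cmod (2 * a + 1 + 2 * INR j)
             = (2 * INR j + 1) * Cmod (kummer_sum a (2 * j)))%R).
  { destruct (kummer_sum_odd a j ha) as [E1 E2].
    replace (2 * S j)%nat with (S (S (2 * j))) by lia.
    rewrite E2, <- Cmod_mult, Cmult_comm, E1, Cmod_mult; f_equal.
    replace (2 * INR j + 1) with (RtoC (2 * INR j + 1))
      by (rewrite RtoC_plus, RtoC_mult; reflexivity).
    rewrite Cmod_R, Rabs_pos_eq; lra. }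
  apply (f_equal (fun x => x * / Cmod (2 * a + 1 + 2 * INR j))%R) in R.
  rewrite Rmult_assoc, Rinv_r, Rmult_1_r in R by exact N3.
  rewrite R, <- tech_pow_Rmult.
  rewrite Rabs_pos_eq.
  + field; repeat split; auto; lra.
  + apply Rlt_le, Rdiv_lt_0_compat; [|apply P].
    rewrite <- R, tech_pow_Rmult; apply P.
- replace (Finite q) with (Rbar_mult q (Rbar_inv 1))
    by (simpl; f_equal; field).
  apply is_lim_seq_scal_l, is_lim_seq_inv; [apply kummer_sum_ratio_lim|].
  intros E; injection E; lra.
Qed.

(** The even and the odd part converge separately because the coefficients decay
    geometrically, while [kummer_sum] grows slower than any geometric sequence.
    Convergence of the interleaved series alone would not give this. *)
Lemma kummer_weighted_series (a : C) (c : nat -> C) (rho M : R) :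
  ~ nonpos_integer (2 * a + 1) -> (1 < rho)%R ->
  (forall n, (Cmod (c n) <= M / rho ^ n)%R) ->
  (exists A, Cis_series (fun j => c (2 * j)%nat * kummer_sum a (2 * j)) A) /\
  (exists B, Cis_series (fun j => c (S (2 * j)) * kummer_sum a (S (2 * j))) B).
Proof.
intros ha Hrho Hc.
set (q := (/ rho ^ 2)%R).
assert (Hq : (0 < q < 1)%R).
{ unfold q; split; [apply Rinv_0_lt_compat; nra|].
  rewrite <- Rinv_1; apply Rinv_lt_contravar; nra. }
assert (Sq := kummer_sum_even_summable a q ha Hq).
assert (Eq : forall j, (q ^ j = / rho ^ (2 * j))%R)
  by (intros j; unfold q; rewrite pow_inv, <- pow_mult; reflexivity).
split.
- apply Cis_series_ex_le
    with (fun j => M * (Cmod (kummer_sum a (2 * j)) * q ^ j))%R;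
    [|exact (ex_series_scal M _ Sq)].
  intros j; rewrite Cmod_mult, Eq.
  replace (M * (Cmod (kummer_sum a (2 * j)) * / rho ^ (2 * j)))%R
    with (M / rho ^ (2 * j) * Cmod (kummer_sum a (2 * j)))%R
    by (unfold Rdiv; ring).
  apply Rmult_le_compat_r; [apply Cmod_ge_0|apply Hc].
- (* The odd sums equal the next even ones: shift the even majorant. *)
  apply Cis_series_ex_le
    with (fun j => M * rho * (Cmod (kummer_sum a (2 * S j)) * q ^ S j))%R.
  + intros j; rewrite Cmod_mult, Eq.
    replace (2 * S j)%nat with (S (S (2 * j))) by lia.
    rewrite (proj2 (kummer_sum_odd a j ha)).
    replace (M * rho * (Cmod (kummer_sum a (S (2 * j))) * / rho ^ S (S (2 * j))))%R
      with (M / rho ^ S (2 * j) * Cmod (kummer_sum a (S (2 * j))))%R.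
    * apply Rmult_le_compat_r; [apply Cmod_ge_0|apply Hc].
    * simpl; field; split; [apply pow_nonzero|]; lra.
  + apply (ex_series_scal (M * rho)%R
      (fun j => Cmod (kummer_sum a (2 * S j)) * q ^ S j)%R).
    apply (ex_series_incr_1 (fun j => Cmod (kummer_sum a (2 * j)) * q ^ j)%R), Sq.
Qed.

Theorem theorem2 (R0 : R) (phi : C -> C) (a d : C)
  (hR0 : (1 < R0)%R)
  (hphi : analytic_in_disc phi 1 R0)
  (ha : ~ nonpos_integer (2 * a + 1))
  (hd : ~ nonpos_integer d)
  (hinv : summation_invertible a d phi) :
  exists L A B : C,
    Cis_series
      (fun k => 2 ^ k * Cpoch a k * Cpoch (d + 1) k * Cderive_n phi k 0
                / (Cpoch (2 * a + 1) k * Cpoch d k * INR (fact k))) L /\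
    Cis_series
      (fun k => Cderive_n phi (2 * k) 1
                / (2 ^ (2 * k) * Cpoch (a + 1 / 2) k * INR (fact k))) A /\
    Cis_series
      (fun k => Cderive_n phi (2 * k + 1) 1
                / (2 ^ (2 * k) * Cpoch (a + 3 / 2) k * INR (fact k))) B /\
    L = A - (1 - 2 * a / d) / (2 * a + 1) * B.
Proof.
set (rho := ((1 + R0) / 2)%R).
assert (Hrho : (1 < rho < R0)%R) by (unfold rho; lra).
destruct (analytic_disc_taylor_derive_n phi 1 rho R0) as (c & M & Hc & Ht);
  [lra|exact hphi|].
assert (D1 : forall k, Cderive_n phi k 1 = INR (fact k) * c k).
{ intros k; assert (H := Ht k 1%R); rewrite Rminus_diag, Rabs_R0 in H.
  apply (Cis_series_unique _ _ _ (H ltac:(lra))); apply Cis_series_single.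
  - simpl; unfold Rdiv; rewrite Rinv_1, Rmult_1_r; ring.
  - intros m; simpl; ring. }
assert (D0 : forall k, Cis_series (inner_term phi k) (Cderive_n phi k 0)).
{ intros k; assert (H := Ht k 0%R).
  rewrite Rminus_0_l, Rabs_Ropp, Rabs_R1 in H.
  apply Cis_series_ext with (2 := H ltac:(lra)).
  intros m; symmetry; apply inner_term_taylor, D1. }
destruct hinv as (T & V & HT & HS1 & HS2).
assert (TE : forall k, T k = Cderive_n phi k 0)
  by (intros k; exact (Cis_series_unique _ _ _ (HT k) (D0 k))).
assert (TA : forall j, Cderive_n phi (2 * j) 1
    / (2 ^ (2 * j) * Cpoch (a + 1 / 2) j * INR (fact j))
  = c (2 * j)%nat * kummer_sum a (2 * j)).
{ intros j; rewrite D1, <- (kummer_sum_even_closed a j ha).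
  field; repeat split; [apply fact_C_neq_0| |].
  - apply (half_poch_neq_0 a _ 0 j ha); simpl; ring.
  - apply Cpow_nz, RtoC_neq_0; lra. }
assert (TB : forall j, Cderive_n phi (2 * j + 1) 1
    / (2 ^ (2 * j) * Cpoch (a + 3 / 2) j * INR (fact j))
  = (2 * a + 1) * (c (S (2 * j)) * kummer_sum a (S (2 * j)))).
{ intros j; replace (2 * j + 1)%nat with (S (2 * j)) by lia.
  rewrite D1, <- (kummer_sum_odd_closed a j ha).
  field; repeat split; [apply fact_C_neq_0| |].
  - apply (half_poch_neq_0 a _ 1 j ha); simpl; field; apply RtoC_neq_0; lra.
  - apply Cpow_nz, RtoC_neq_0; lra. }
destruct (kummer_weighted_series a c rho M ha (proj1 Hrho) Hc) as [[A HA] [B HB]].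
exists V, A, ((2 * a + 1) * B); repeat split.
- apply Cis_series_ext with (2 := HS1); intros k; rewrite TE.
  unfold hyp_coef, Cdiv; ring.
- apply Cis_series_ext with (2 := HA); intros j; symmetry; apply TA.
- apply Cis_series_ext with (2 := Cis_series_scal (2 * a + 1) _ _ HB).
  intros j; symmetry; apply TB.
- assert (a0 := nonpos_free_neq_0 _ ha); assert (d0 := nonpos_free_neq_0 _ hd).
  replace ((1 - 2 * a / d) / (2 * a + 1) * ((2 * a + 1) * B))
    with ((1 - 2 * a / d) * B) by (field; split; assumption).
  replace (A - (1 - 2 * a / d) * B) with (1 * A + - (1 - 2 * a / d) * B) by ring.
  (* In the second iterated series, adding the terms of index [2j] and [2j + 1]
     gives the [j]-th terms of both series on the right. *)
  apply (Cis_series_unique _ _ _ (Cis_series_pairs _ _ HS2)).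
  apply Cis_series_ext with (2 := Cis_series_lin 1 (- (1 - 2 * a / d)) _ _ _ _ HA HB).
  intros j; rewrite !D1, hyp_sum_even, hyp_sum_odd by assumption.
  rewrite Cpow_S, m1_pow_double.
  field; repeat split; try exact d0; apply fact_C_neq_0.
Qed.
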